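(* Let $d\ge 1$ and let $\Omega\subset\mathbb{R}^d$ be a bounded open set. For each $t$ with $0<t<(\psi,1)$ there exists $f\in V_t$ such that $\beta_t=J(f)$.
   Context: $m$ is Lebesgue measure on $\Omega$, and $(\cdot,\cdot)$ is the standard inner product of the real Hilbert space $\mathscr{H}=L^2(\Omega,m)$. $G$ is the Green operator of the non-negative Dirichlet Laplacian $-\Delta$ in $\mathscr{H}$: for $f\in\mathscr{H}$, $u=Gf$ is the unique element of $W^{1,2}_0(\Omega)$ with $\int_\Omega \nabla u\cdot\nabla v\,dm=(f,v)$ for all $v\in W^{1,2}_0(\Omega)$. The torsion function is $\psi:=G\chi_\Omega$, so $(\psi,1)=\int_\Omega\psi\,dm$. For $f\in\mathscr{H}$, $J(f):=(f,Gf)$. For $0<t<(\psi,1)$, $$V_t:=\{f\in\mathscr{H}:\ 0\le f\le 1\ m\text{-a.e. on }\Omega\text{ and }(f,\psi)\le t\},\qquad \beta_t:=\sup\{J(f): f\in V_t\}.$$ *)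

(* Defs.v *)
From HB Require Import structures.
From mathcomp Require Import all_boot all_order all_algebra.
From mathcomp Require Import all_classical all_reals all_analysis.

Set Implicit Arguments.
Unset Strict Implicit.
Unset Printing Implicit Defensive.
Import Order.TTheory GRing.Theory Num.Theory.
Import numFieldNormedType.Exports.
Local Open Scope classical_set_scope.
Local Open Scope ring_scope.

Definition measure_rV_display : measure_display.
Proof. exact. Qed.

Section measurable_rV.
Context {R : realType}.
Variable n : nat.

Let coord (i : 'I_n) (x : 'rV[R]_n) : measurableTypeR R := x ord0 i.

Let rV_set0 : g_sigma_preimage coord set0.
Proof. exact: sigma_algebra0. Qed.

Let rV_setC A : g_sigma_preimage coord A -> g_sigma_preimage coord (~` A).
Proof. exact: sigma_algebraC. Qed.

Let rV_bigcup (F : (set 'rV[R]_n)^nat) :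
  (forall i, g_sigma_preimage coord (F i)) ->
  g_sigma_preimage coord (\bigcup_i (F i)).
Proof. exact: sigma_algebra_bigcup. Qed.

(* The product sigma-algebra on R^n; see open_measurable_rV below. *)
HB.instance Definition _ := @isMeasurable.Build measure_rV_display
  'rV[R]_n (g_sigma_preimage coord) rV_set0 rV_setC rV_bigcup.

Lemma measurable_rV_coord (i : 'I_n) :
  measurable_fun [set: 'rV[R]_n] (fun x => x ord0 i : measurableTypeR R).
Proof.
move=> _ Y mY; rewrite setTI; apply: sub_sigma_algebra => /=.
rewrite -bigcup_seq/=; exists i => /=; first by rewrite mem_index_enum.
by exists Y => //; rewrite setTI.
Qed.

Lemma measurable_fun_rVP d (T : measurableType d) (f : T -> 'rV[R]_n) :
  (forall i, measurable_fun [set: T] (fun x => f x ord0 i : measurableTypeR R))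
  -> measurable_fun [set: T] f.
Proof.
move=> mf _ A mA; rewrite setTI; move: A mA.
suff : @measurable _ 'rV[R]_n `<=` [set A | measurable (f @^-1` A)] by [].
apply: smallest_sub.
  split=> /=; first by rewrite preimage_set0.
  - by move=> A mA; rewrite setTD preimage_setC; exact: measurableC.
  - by move=> F mF; rewrite preimage_bigcup; exact: bigcupT_measurable.
rewrite -bigcup_seq/= => A [i _ [B mB <-]] /=.
by have := mf i measurableT B mB; rewrite !setTI.
Qed.

Lemma open_measurable_rV (U : set 'rV[R]_n) : open U -> measurable U.
Proof.
move=> oU.
pose B (p : 'rV[rat]_n * 'rV[rat]_n) := [set x : 'rV[R]_n |
  forall i, ratr (p.1 ord0 i) < x ord0 i < ratr (p.2 ord0 i)].
pose F p := if `[< B p `<=` U >] then B p else set0.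
have -> : U = \bigcup_p F p.
  apply/seteqP; split => [x Ux|x [p _]]; last first.
    by rewrite /F; case: asboolP => // + Bx; exact.
  have /nbhs_ballP[e /= e0 eU] := open_nbhs_nbhs (conj oU Ux).
  have hlo i : exists q : rat, ratr q \in `](x ord0 i - e), (x ord0 i)[.
    by apply: rat_in_itvoo; rewrite ltrBlDr ltrDl.
  have hhi i : exists q : rat, ratr q \in `](x ord0 i), (x ord0 i + e)[.
    by apply: rat_in_itvoo; rewrite ltrDl.
  have [a ha] := choice hlo; have [b hb] := choice hhi.
  exists (\row_i a i, \row_i b i) => //.
  have Bx : B (\row_i a i, \row_i b i) x.
    move=> i; rewrite !mxE/=.
    by move: (ha i) (hb i); rewrite !in_itv/= => /andP[_ ->] /andP[-> _].
  rewrite /F; case: asboolP => // -[] y By; apply: eU; split => // i j.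
  rewrite [i]ord1 /ball/= ltr_distlC; move: (By j); rewrite !mxE/=.
  move: (ha j) (hb j); rewrite !in_itv/= => /andP[h1 _] /andP[_ h2].
  by move=> /andP[h3 h4]; rewrite (lt_trans h1 h3) (lt_trans h4 h2).
apply: countable_bigcupT_measurable; first exact: countableP.
move=> p; rewrite /F; case: asboolP => // _.
have -> : B p = \bigcap_(i in [set: 'I_n])
    ((fun x : 'rV[R]_n => x ord0 i) @^-1`
      `](ratr (p.1 ord0 i)), (ratr (p.2 ord0 i))[%classic).
  apply/seteqP; split => [x Bx i _ /=|x Bx i]; first by rewrite in_itv/= Bx.
  by have := Bx i I; rewrite /= in_itv.
apply: fin_bigcap_measurable => // i _.
rewrite -[X in measurable X]setTI.
by apply: measurable_rV_coord => //; exact: measurable_itv.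
Qed.

End measurable_rV.

Section lebesgue_rV.
Context {R : realType}.

Definition row_cons n (p : measurableTypeR R * 'rV[R]_n) : 'rV[R]_n.+1 :=
  \row_(i < n.+1) if unlift ord0 i is Some j then p.2 ord0 j else p.1.

Lemma measurable_row_cons n : measurable_fun setT (@row_cons n).
Proof.
apply: measurable_fun_rVP => i.
under eq_fun do rewrite /row_cons mxE.
case: unliftP => [j _|_]; last exact: measurable_fst.
exact: (measurableT_comp (measurable_rV_coord j) measurable_snd).
Qed.

Definition lebesgue_cons n (m : {sigma_finite_measure set 'rV[R]_n -> \bar R})
  : set 'rV[R]_n.+1 -> \bar R :=
  pushforward (lebesgue_measure \x m)%E (@row_cons n).

HB.instance Definition _ n (m : {sigma_finite_measure set 'rV[R]_n -> \bar R})
  := Measure.copy (lebesgue_cons m)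
    (measure_function_pushforward__canonical__measure_function_Measure
      (lebesgue_measure \x m)%E (@measurable_row_cons n)).

Let sigma_finite_cons n (m : {sigma_finite_measure set 'rV[R]_n -> \bar R}) :
  sigma_finite setT (lebesgue_cons m).
Proof.
have /sigma_finiteP[F [TF ndF Foo]] := sigma_finiteT (@lebesgue_measure R).
have /sigma_finiteP[G [TG ndG Goo]] := sigma_finiteT m.
pose tail (x : 'rV[R]_n.+1) : 'rV[R]_n := \row_i x ord0 (lift ord0 i).
have mtail : measurable_fun setT tail.
  apply: measurable_fun_rVP => i.
  by under eq_fun do rewrite mxE; exact: measurable_rV_coord.
exists (fun k => (fun x : 'rV[R]_n.+1 => x ord0 ord0) @^-1` F k `&` tail @^-1` G k).
  apply/esym/seteqP; split => // x _.
  have [j _ Fj] : (\bigcup_i F i) (x ord0 ord0) by rewrite -TF.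
  have [i _ Gi] : (\bigcup_i G i) (tail x) by rewrite -TG.
  exists (maxn i j) => //; split.
    have /subsetPset := ndF _ _ (leq_maxr i j); exact.
  have /subsetPset := ndG _ _ (leq_maxl i j); exact.
move=> k; have [mF Fk] := Foo k; have [mG Gk] := Goo k; split.
  apply: measurableI; rewrite -[X in measurable X]setTI; last exact: mtail.
  exact: measurable_rV_coord.
rewrite /lebesgue_cons /pushforward (_ : _ @^-1` _ = F k `*` G k).
  by rewrite product_measure1E// lte_mul_pinfty// ge0_fin_numE.
apply/seteqP; split => -[a v] /=; rewrite /row_cons mxE unlift_none/=;
  rewrite (_ : tail _ = v)//; by apply/rowP => i; rewrite !mxE liftK.
Qed.

HB.instance Definition _ n (m : {sigma_finite_measure set 'rV[R]_n -> \bar R})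
  := Measure_isSigmaFinite.Build _ _ _ (lebesgue_cons m) (sigma_finite_cons m).

Fixpoint lebesgue_rV n : {sigma_finite_measure set 'rV[R]_n -> \bar R} :=
  if n is n'.+1 then lebesgue_cons (lebesgue_rV n') else \d_(0 : 'rV[R]_0).

(* lebesgue_rV n is the n-fold product of the one-dimensional measure. *)
Lemma lebesgue_rV_box n (A : 'I_n -> set R) :
  (forall i, measurable (A i : set (measurableTypeR R))) ->
  lebesgue_rV n [set x | forall i, A i (x ord0 i)] =
  (\prod_(i < n) (lebesgue_measure (A i)))%E.
Proof.
elim: n A => [A _|n IH A mA].
  rewrite big_ord0 /= diracE mem_set//=; by case.
rewrite big_ord_recl -IH//.
rewrite -[LHS]/((lebesgue_measure \x lebesgue_rV n)%E (@row_cons n @^-1` _)).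
pose B := [set x : 'rV[R]_n | forall i, A (lift ord0 i) (x ord0 i)].
transitivity ((lebesgue_measure \x lebesgue_rV n)%E (A ord0 `*` B)).
  congr (_ _); apply/seteqP; split => -[a v] /=; rewrite /row_cons.
    move=> H; split; first by have := H ord0; rewrite mxE unlift_none.
    by move=> i; have := H (lift ord0 i); rewrite mxE liftK.
  by move=> [Aa Av] i; rewrite mxE; case: unliftP => [j ->|->] //; exact: Av.
apply: product_measure1E => //.
rewrite (_ : B = \bigcap_(i in [set: 'I_n])
   ((fun x : 'rV[R]_n => x ord0 i) @^-1` A (lift ord0 i))).
  apply: fin_bigcap_measurable => // i _; rewrite -[X in measurable X]setTI.
  by apply: measurable_rV_coord.
by apply/seteqP; split => x Bx i; [move=> _; exact: Bx|exact: (Bx i I)].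
Qed.

End lebesgue_rV.

Section smooth.
Context {R : realType} {d : nat}.
Implicit Types f : 'rV[R]_d -> R.

Definition partial (i : 'I_d) f : 'rV[R]_d -> R :=
  fun x => 'D_(delta_mx ord0 i) f x.

(* s ranges over the multi-indices, written as words in the coordinates. *)
Definition smooth f := forall s : seq 'I_d,
  continuous (foldr partial f s) /\
  forall i x, derivable (foldr partial f s) x (delta_mx ord0 i).

Definition test_function (Omega : set 'rV[R]_d) f :=
  [/\ smooth f, compact (closure [set x | f x != 0]) &
      closure [set x | f x != 0] `<=` Omega].

End smooth.

Section dirichlet.
Context {R : realType} {d : nat} {Omega : set 'rV[R]_d}.
Variable oOmega : open Omega.
Implicit Types (f u v : 'rV[R]_d -> R) (g h : 'I_d -> 'rV[R]_d -> R).

Definition lebesgue_on : {measure set 'rV[R]_d -> \bar R} :=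
  mrestr (lebesgue_rV d) (open_measurable_rV oOmega).

(* Elements of L^2(Omega, m) are given by representatives; everything below
   only depends on the m-a.e. classes on Omega. *)
Definition L2 : set ('rV[R]_d -> R) := [set f | f \in Lfun lebesgue_on 2%:E].

Definition inner f v : R := \int[lebesgue_on]_x (f x * v x).

Definition weak_gradient u g := forall i, L2 (g i) /\
  forall phi, test_function Omega phi ->
    inner u (partial i phi) = - inner (g i) phi.

Definition W12_sqnorm u g : R :=
  inner u u + \sum_(i < d) inner (g i) (g i).

(* W_0^{1,2}(Omega), the closure of the test functions in W^{1,2}(Omega); its
   elements u come with their weak gradient g. *)
Definition W12_0 u g := [/\ L2 u, weak_gradient u g &
  forall e, 0 < e -> exists2 phi, test_function Omega phi &
    W12_sqnorm (u - phi) (fun i => g i - partial i phi) < e].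

Definition dirichlet_solution f u := exists2 g, W12_0 u g &
  forall v h, W12_0 v h -> \sum_(i < d) inner (g i) (h i) = inner f v.

(* A representative of G f, which is unique up to m-a.e. equality. *)
Definition green f : 'rV[R]_d -> R := get (dirichlet_solution f).

Definition torsion : 'rV[R]_d -> R := green \1_Omega.

Definition J f : R := inner f (green f).

Definition V (t : R) : set ('rV[R]_d -> R) := [set f | [/\ L2 f,
  {ae lebesgue_on, forall x, 0 <= f x <= 1} & inner f torsion <= t]].

(* The supremum is taken in \bar R so that no boundedness is presupposed. *)
Definition beta (t : R) : \bar R := ereal_sup [set (J f)%:E | f in V t].

End dirichlet.

(* Main.v *)
(* [J] is the square of a seminorm which is bounded by a multiple of the L^2
   norm and for which, by the compactness of [G], the set of functions with
   values in [0, 1] is totally bounded.  Cutting [V_t] successively into finitely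
   many pieces of small [J]-diameter and keeping a piece on which [J] has the same
   supremum yields a maximizing sequence (f_j) that is Cauchy for this seminorm.
   The sets of those g in [V_t] that are [J]-close to f_0, ..., f_k are convex,
   nonempty and decreasing, so their elements of almost minimal L^2 norm are
   Cauchy in L^2; the limit is in [V_t] and maximizes [J].  Weak topologies are
   avoided altogether.

   The Poincare and Rellich estimates rest on the inequality
   |u(. + h e) - u|_1 <= |h| |D_e u|_1, which only needs the translation
   invariance of the Lebesgue measure.  *)
Require Import Defs.
From HB Require Import structures.
From mathcomp Require Import all_boot all_order all_algebra.
From mathcomp Require Import all_classical all_reals all_analysis.
From mathcomp Require Import measurable_realfun ring lra.
Set Implicit Arguments.
Unset Strict Implicit.
Unset Printing Implicit Defensive.
Import Order.TTheory GRing.Theory Num.Theory.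
Import numFieldNormedType.Exports.
Local Open Scope classical_set_scope.
Local Open Scope ring_scope.

(** [V oOmega t] is convex and bounded, but it need not be norm compact, and [J] is convex: along a
    weak limit of a maximizing sequence, weak lower semicontinuity of [J] is an inequality in the
    wrong direction. The finite cuts recover what the compactness of G would give. They are obtained
    by duality: by [J_le], [J w] is small as soon as the products of [w] with test functions are
    small relative to the square root of their energy, and for [|w| <= 1] this only asks for L^1
    estimates on test functions. Two functions with nearly equal integrals over the cells of a fine
    grid have such a difference [w], because a test function is L^1-close to its means over the
    cells. All estimates are thus made on test functions, and W_0^{1,2} enters only through limits.
    Since functions are representatives and not classes, every form is merely semidefinite, and
    convergence is expressed through squared seminorms. *)

Definition natSinv {R : realType} (k : nat) : R := k.+1%:R^-1.

Lemma natSinv_gt0 {R : realType} k : 0 < natSinv k :> R.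
Proof. by rewrite invr_gt0. Qed.

Lemma ex_natSinv_le {R : realType} (e : R) : 0 < e -> exists n, natSinv n <= e.
Proof. by move=> /ltr_add_invr[n]; rewrite add0r => /ltW ?; exists n. Qed.

Lemma le_natSinv {R : realType} j k : (j <= k)%N -> natSinv k <= natSinv j :> R.
Proof. by move=> jk; rewrite lef_pV2 ?posrE// ler_nat ltnS. Qed.

Lemma cvgn_sum {R : realType} {I : Type} (r : seq I) (u : I -> nat -> R) (l : I -> R) :
  (forall i, u i @ \oo --> l i) ->
  (fun k => \sum_(i <- r) u i k) @ \oo --> \sum_(i <- r) l i.
Proof.
move=> ul; elim: r => [|i r IH].
  by rewrite big_nil; under eq_fun do rewrite big_nil; exact: cvg_cst.
by rewrite big_cons; under eq_fun do rewrite big_cons; exact: cvgD.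
Qed.

(** * Positive semidefinite forms *)

Section semi_inner.
Context {R : realType} {E : lmodType R}.
Implicit Types (D V : set E) (a b : E -> E -> R) (Q q : E -> R).

Definition subspace D := D 0 /\ forall k x y, D x -> D y -> D (k *: x + y).

(** The axioms are relative to [D] because an integral of products is linear only where the products
    are integrable. Linearity in the second argument follows from symmetry. *)
Definition semi_inner D a := [/\ forall x y, D x -> D y -> a x y = a y x,
  forall k x y z, D x -> D y -> D z -> a (k *: x + y) z = k * a x z + a y z &
  forall x, D x -> 0 <= a x x].

Definition cauchy q (x : nat -> E) := forall e : R, 0 < e ->
  exists N, forall j k, (N <= j)%N -> (N <= k)%N -> q (x j - x k) <= e.

Lemma subspaceD D : subspace D -> forall x y, D x -> D y -> D (x + y).
Proof. by move=> [_ h] x y Dx Dy; rewrite -[x]scale1r; exact: h. Qed.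

Lemma subspaceZ D : subspace D -> forall k x, D x -> D (k *: x).
Proof. by move=> [h0 h] k x Dx; rewrite -[_ *: _]addr0; exact: h. Qed.

Lemma subspaceB D : subspace D -> forall x y, D x -> D y -> D (x - y).
Proof. by move=> [_ h] x y Dx Dy; rewrite addrC -scaleN1r; exact: h. Qed.

Section theory.
Context (D : set E) (sD : subspace D) (a : E -> E -> R) (ha : semi_inner D a).

Lemma semi_innerC x y : D x -> D y -> a x y = a y x.
Proof. by case: ha => h _ _; exact: h. Qed.

Lemma semi_inner_ge0 x : D x -> 0 <= a x x.
Proof. by case: ha => _ _; exact. Qed.

Lemma semi_innerDl x y z : D x -> D y -> D z -> a (x + y) z = a x z + a y z.
Proof.
by case: ha => _ h _ Dx Dy Dz; rewrite -[x]scale1r h// mul1r scale1r.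
Qed.

Lemma semi_inner0l z : D z -> a 0 z = 0.
Proof.
move=> Dz; have D0 := sD.1; have := semi_innerDl D0 D0 Dz.
by rewrite addr0 => /eqP; rewrite -subr_eq0 opprD addrA subrr add0r oppr_eq0 => /eqP.
Qed.

Lemma semi_innerZl k x z : D x -> D z -> a (k *: x) z = k * a x z.
Proof.
move=> Dx Dz; case: ha => _ h _; rewrite -[_ *: _]addr0 h//; last exact: sD.1.
by rewrite semi_inner0l// addr0.
Qed.

Lemma semi_innerDr x y z : D x -> D y -> D z -> a z (x + y) = a z x + a z y.
Proof.
move=> Dx Dy Dz; rewrite semi_innerC ?semi_innerDl//; last exact: subspaceD.
by rewrite !(semi_innerC Dz).
Qed.

Lemma semi_innerZr k x z : D x -> D z -> a z (k *: x) = k * a z x.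
Proof.
move=> Dx Dz; rewrite semi_innerC ?semi_innerZl//; last exact: subspaceZ.
by rewrite (semi_innerC Dz).
Qed.

Lemma subspace_sum {I : Type} (r : seq I) (x : I -> E) : (forall i, D (x i)) ->
  D (\sum_(i <- r) x i).
Proof.
by move=> Dx; apply: big_rec => [|i y _ Dy]; [exact: sD.1|exact: subspaceD].
Qed.

Lemma semi_inner_sumr {I : Type} (r : seq I) (x : I -> E) z : (forall i, D (x i)) ->
  D z -> a z (\sum_(i <- r) x i) = \sum_(i <- r) a z (x i).
Proof.
move=> Dx Dz; elim: r => [|i r IH].
  by rewrite !big_nil semi_innerC ?semi_inner0l//; exact: sD.1.
by rewrite !big_cons semi_innerDr ?IH//; exact: subspace_sum.
Qed.

Lemma semi_inner_sqD x y : D x -> D y ->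
  a (x + y) (x + y) = a x x + 2 * a x y + a y y.
Proof.
move=> Dx Dy; have Dxy := subspaceD sD Dx Dy.
rewrite semi_innerDl// !semi_innerDr// (semi_innerC Dy)//; ring.
Qed.

Lemma semi_inner_sqZ k x : D x -> a (k *: x) (k *: x) = k ^+ 2 * a x x.
Proof.
move=> Dx; have Dkx := subspaceZ sD k Dx.
rewrite semi_innerZl// semi_innerZr//; ring.
Qed.

Lemma semi_inner_lin k x y : D x -> D y ->
  a (k *: x + y) (k *: x + y) = k ^+ 2 * a x x + 2 * k * a x y + a y y.
Proof.
move=> Dx Dy; have Dkx := subspaceZ sD k Dx.
rewrite semi_inner_sqD// semi_inner_sqZ// semi_innerZl//; ring.
Qed.

Lemma semi_inner_sqB x y : D x -> D y ->
  a (x - y) (x - y) = a x x - 2 * a x y + a y y.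
Proof.
move=> Dx Dy; rewrite addrC -scaleN1r semi_inner_lin// (semi_innerC Dy)//; ring.
Qed.

Lemma semi_inner_sqBC x y : D x -> D y -> a (x - y) (x - y) = a (y - x) (y - x).
Proof. by move=> Dx Dy; rewrite !semi_inner_sqB// (semi_innerC Dy Dx); ring. Qed.

Lemma semi_inner_sq_half x y : D x -> D y ->
  a (2^-1 *: (x + y)) (2^-1 *: (x + y)) =
  2^-1 * a x x + 2^-1 * a y y - 4^-1 * a (x - y) (x - y).
Proof.
move=> Dx Dy; rewrite semi_inner_sqZ; last exact: subspaceD.
by rewrite semi_inner_sqD// semi_inner_sqB//; field.
Qed.

Lemma semi_inner_sqD_le x y : D x -> D y ->
  a (x + y) (x + y) <= 2 * a x x + 2 * a y y.
Proof.
move=> Dx Dy; have := semi_inner_ge0 (subspaceB sD Dx Dy).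
rewrite semi_inner_sqB// semi_inner_sqD//; lra.
Qed.

(** Divide the square of [y - k *: x] by [k]. A small [k] keeps the coefficient of [a x x] close to
    1, so that replacing a vector by a nearby one costs little. *)
Lemma semi_inner_peter_paul k x y : 0 < k -> D x -> D y ->
  a (x + y) (x + y) <= (1 + k) * a x x + (1 + k^-1) * a y y.
Proof.
move=> k0 Dx Dy.
have := semi_inner_ge0 (sD.2 (- k) _ _ Dx Dy); rewrite semi_inner_lin// => h.
rewrite semi_inner_sqD//.
have : 0 <= k^-1 * ((- k) ^+ 2 * a x x + 2 * - k * a x y + a y y).
  by rewrite mulr_ge0// invr_ge0 ltW.
have -> : k^-1 * ((- k) ^+ 2 * a x x + 2 * - k * a x y + a y y) =
  k * a x x - 2 * a x y + k^-1 * a y y by field; rewrite gt_eqF.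
lra.
Qed.

Lemma semi_inner_cauchy_schwarz x y : D x -> D y ->
  a x y ^+ 2 <= a x x * a y y.
Proof.
move=> Dx Dy; have ax := semi_inner_ge0 Dx; have ay := semi_inner_ge0 Dy.
have H k : 0 <= k ^+ 2 * a x x + 2 * k * a x y + a y y.
  by rewrite -semi_inner_lin//; apply: semi_inner_ge0; exact: sD.2.
(* If [x] is a null vector, the quadratic [H] is affine in [k], and unless [a x y = 0] the chosen
   [k] gives it the value -1. *)
have [ax0|axn0] := eqVneq (a x x) 0.
  have [->|axy] := eqVneq (a x y) 0; first by rewrite expr0n/= mulr_ge0.
  have := H (- (a y y + 1) / (2 * a x y)).
  rewrite ax0 mulr0 add0r.
  have -> : 2 * (- (a y y + 1) / (2 * a x y)) * a x y + a y y = -1 by field.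
  by rewrite lerNr oppr0 ler10.
have {}ax : 0 < a x x by rewrite lt_neqAle eq_sym axn0.
have := H (- a x y / a x x).
have -> : (- a x y / a x x) ^+ 2 * a x x + 2 * (- a x y / a x x) * a x y + a y y
  = (a x x * a y y - a x y ^+ 2) / a x x by field.
by rewrite pmulr_lge0 ?invr_gt0// subr_ge0.
Qed.

End theory.

(* The uniform-convexity argument behind the projection theorem, for a
   decreasing sequence of convex sets: the infima of [Q] increase to a finite
   limit, so near-minimisers are Cauchy by the parallelogram identity. *)
Lemma nested_minimizers Q q (C : nat -> set E) m0 M0 :
  (forall j k, (j <= k)%N -> C k `<=` C j) ->
  (forall k, exists2 x, C k x & Q x <= M0) ->
  (forall x, C 0%N x -> m0 <= Q x) ->
  (forall k x y, C k x -> C k y -> C k (2^-1 *: (x + y))) ->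
  (forall x y, C 0%N x -> C 0%N y ->
    Q (2^-1 *: (x + y)) = 2^-1 * Q x + 2^-1 * Q y - 4^-1 * q (x - y)) ->
  exists x, [/\ forall k, C k (x k), cauchy q x &
    forall k y, C k y -> Q (x k) <= Q y + natSinv k].
Proof.
move=> ndC neC lbQ midC midQ.
have C0 k : C k `<=` C 0%N by exact: ndC.
pose m k := inf (Q @` C k).
have hasm k : has_inf (Q @` C k).
  split; first by have [x Cx _] := neC k; exists (Q x), x.
  by exists m0 => _ [x Cx <-]; exact/lbQ/(C0 k).
have mle k x : C k x -> m k <= Q x.
  by move=> Cx; apply: ge_inf; [exact: (hasm k).2|exists x].
have mM k : m k <= M0 by have [x Cx xM] := neC k; exact: le_trans (mle _ _ Cx) xM.
have m_nd j k : (j <= k)%N -> m j <= m k.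
  move=> jk; apply: lb_le_inf; first exact: (hasm k).1.
  by move=> _ [x Cx <-]; exact/mle/(ndC _ _ jk).
have ex k : exists x, C k x /\ Q x < m k + natSinv k.
  have k0 : 0 < natSinv k :> R by exact: natSinv_gt0.
  by have [_ [x Cx <-] Qx] := inf_adherent k0 (hasm k); exists x.
have [x xP] := choice ex.
exists x; split; first by move=> k; exact: (xP k).1.
  move=> e e0.
  have hs : has_sup (range m) by split; [exists (m 0%N), 0%N|exists M0 => _ [k _ <-]].
  (* Beyond [N] the values of [Q] are at most [sup + e / 8], while [m N] exceeds [sup - e / 8]; the
     factor 4 of the midpoint identity turns the gap [e / 4] into [e]. *)
  have e8 : 0 < e / 8 by lra.
  have [_ [N1 _ <-] mN1] := sup_adherent e8 hs.
  have [N2 N2e] := ex_natSinv_le e8.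
  pose N := maxn N1 N2.
  have NN : natSinv N <= e / 8 by apply: le_trans N2e; exact/le_natSinv/leq_maxr.
  exists N => j k Nj Nk.
  have Cj : C N (x j) by apply: (ndC _ _ Nj); exact: (xP j).1.
  have Ck : C N (x k) by apply: (ndC _ _ Nk); exact: (xP k).1.
  have := mle _ _ (midC _ _ _ Cj Ck); rewrite midQ; [|exact: C0 Cj|exact: C0 Ck].
  have ms i : m i <= sup (range m) by apply: ub_le_sup; [exact: hs.2|exists i].
  have m1N := m_nd _ _ (leq_maxl N1 N2).
  move: (@le_natSinv R _ _ Nj) (@le_natSinv R _ _ Nk) m1N.
  move: (ms j) (ms k) (xP j).2 (xP k).2 NN mN1; rewrite -/N.
  lra.
move=> k y Cy; have := mle _ _ Cy; have := (xP k).2; lra.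
Qed.

Definition limit q (x : nat -> E) y := forall e : R, 0 < e ->
  exists N, forall k, (N <= k)%N -> q (x k - y) <= e.

Section limit.
Context (D : set E) (sD : subspace D) (a : E -> E -> R) (ha : semi_inner D a).
Context (x : nat -> E) (y : E) (Dx : forall k, D (x k)) (Dy : D y).
Context (xy : limit (fun z => a z z) x y).

Lemma limit_sqB : (fun k => a (x k - y) (x k - y)) @ \oo --> (0 : R).
Proof.
apply/cvgr0Pnorm_le => e e0; have [N xN] := xy e0; exists N => // k /= Nk.
by rewrite ger0_norm ?xN//; apply: (semi_inner_ge0 ha); exact: subspaceB.
Qed.

Lemma limit_inner z : D z -> (fun k => a (x k) z) @ \oo --> a y z.
Proof.
move=> Dz; have DB k : D (x k - y) by exact: subspaceB.
rewrite (_ : (fun k => _) = (fun k => a (x k - y) z + a y z)); last first.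
  by apply/funext => k; rewrite -(semi_innerDl ha)// subrK.
rewrite -[X in _ --> X]add0r; apply: cvgD; last exact: cvg_cst.
apply/cvgr0Pnorm_le => e e0; have az := semi_inner_ge0 ha Dz.
have d0 : 0 < e ^+ 2 / (a z z + 1) by rewrite divr_gt0 ?exprn_gt0//; lra.
have [N xN] := xy d0; exists N => // k /= Nk.
rewrite -(@ler_pXn2r _ 2)// ?nnegrE ?(ltW e0)// real_normK ?num_real//.
apply: le_trans (semi_inner_cauchy_schwarz sD ha (DB k) Dz) _.
apply: le_trans (ler_wpM2r az (xN _ Nk)) _.
rewrite mulrAC ler_pdivrMr ?ler_pM2l ?exprn_gt0//; lra.
Qed.

Lemma limit_sq : (fun k => a (x k) (x k)) @ \oo --> a y y.
Proof.
have DB k : D (x k - y) by exact: subspaceB.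
rewrite (_ : (fun k => _) = (fun k => a (x k - y) (x k - y)
    + (2 * (a (x k) y - a y y) + a y y))); last first.
  apply/funext => k; have := semi_innerDl ha (DB k) Dy Dy; rewrite subrK => ->.
  by have := semi_inner_sqD sD ha (DB k) Dy; rewrite subrK => ->; ring.
rewrite -[X in _ --> X]add0r; apply: cvgD; first exact: limit_sqB.
rewrite -[X in _ --> X]add0r; apply: cvgD; last exact: cvg_cst.
rewrite -[X in _ --> X](mulr0 2); apply: cvgM; first exact: cvg_cst.
by rewrite -[X in _ --> X](subrr (a y y)); apply: cvgB; [exact: limit_inner|exact: cvg_cst].
Qed.

End limit.

(* [V] need not be compact for [a]: total boundedness for the weaker form [b]
   isolates nested subsets of [V] of small [b]-diameter with the same supremum,
   and near-minimisers of [a] in nested convex neighbourhoods converge. *)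
Lemma semi_inner_max_attained D V a b K M :
  subspace D -> semi_inner D a -> semi_inner D b ->
  (forall x, (forall k, D (x k)) -> cauchy (fun z => a z z) x ->
    exists2 y, D y & limit (fun z => a z z) x y) ->
  V `<=` D -> V !=set0 ->
  (forall x y, V x -> V y -> V (2^-1 *: (x + y))) ->
  (forall x y, (forall k, V (x k)) -> D y -> limit (fun z => a z z) x y -> V y) ->
  (forall x, V x -> a x x <= M) ->
  0 < K -> (forall x, D x -> b x x <= K * a x x) ->
  (forall e : R, 0 < e -> exists (I : finType) (c : E -> I),
    forall x y, V x -> V y -> c x = c y -> b (x - y) (x - y) <= e) ->
  exists2 x, V x & forall y, V y -> b y y <= b x x.
Proof.
move=> sD ha hb cD VD V0 midV clV bV K0 bK tb.
pose s := sup [set b x x | x in V].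
have hs : has_sup [set b x x | x in V].
  split; first by have [x Vx] := V0; exists (b x x), x.
  exists (K * M) => _ [x Vx <-]; apply: le_trans (bK _ (VD _ Vx)) _.
  by rewrite ler_pM2l// bV.
have bs x : V x -> b x x <= s by move=> Vx; apply: ub_le_sup; [exact: hs.2|exists x].
(* The pieces worth keeping: those on which [b] still has supremum [s]. *)
pose P S := S `<=` V /\ forall e, 0 < e -> exists2 x, S x & s - e < b x x.
have PV : P V.
  by split=> // e e0; have [_ [x Vx <-] xs] := sup_adherent e0 hs; exists x.
have step (S : {S | P S}) (k : nat) : exists S' : {S | P S},
    sval S' `<=` sval S /\ forall x y, sval S' x -> sval S' y ->
      b (x - y) (x - y) <= natSinv k.
  case: S => S [SV Ss] /=.
  have k0 : 0 < natSinv k :> R by exact: natSinv_gt0.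
  have [I [c cP]] := tb _ k0.
  suff [i iP] : exists i, P (S `&` [set x | c x = i]).
    exists (exist _ _ iP) => /=; split; first by move=> x [].
    by move=> x y [Sx cx] [Sy cy]; apply: cP; [exact: SV|exact: SV|rewrite cx cy].
  (* Pigeonhole: if each colour class stayed below [s] by its own margin, the least of these
     finitely many margins would be a margin for all of [S]. *)
  apply: contrapT => /forallNP nP.
  have ex i : exists e, 0 < e /\ forall x, S x -> c x = i -> b x x <= s - e.
    apply: contrapT => /forallNP ne; apply: (nP i); split=> [x [Sx _]|e e0].
      exact: SV.
    apply: contrapT => nx; apply: (ne e); split=> // x Sx cx.
    by rewrite leNgt; apply/negP => xs; apply: nx; exists x.
  have [e eP] := choice ex.
  pose e0 := \big[Num.min/1]_i e i.
  have e00 : 0 < e0 by apply: lt_bigmin => // i _; exact: (eP i).1.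
  have [x Sx] := Ss _ e00; apply/negP; rewrite -leNgt.
  apply: le_trans ((eP (c x)).2 _ Sx erefl) _; rewrite lerD2l lerN2.
  by apply: bigmin_le.
(* Choosing over the subtype carries [P] along the recursion that defines the pieces. *)
have [next nextP] := choice (fun p : {S | P S} * nat => step p.1 p.2).
pose S := fix S k := if k is j.+1 then next (S j, k) else next (exist _ _ PV, 0%N).
have Sd k x y : sval (S k) x -> sval (S k) y -> b (x - y) (x - y) <= natSinv k.
  by case: k => [|k] /=; apply: (nextP _).2.
have ndS j k : (j <= k)%N -> sval (S k) `<=` sval (S j).
  move=> /subnK <-; elim: (k - j)%N => [//|n IH] x.
  by rewrite addSn => /(nextP _).1; exact: IH.
have exf k : exists x, sval (S k) x /\ s - natSinv k < b x x.
  have k0 : 0 < natSinv k :> R by exact: natSinv_gt0.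
  by have [x Sx xs] := (svalP (S k)).2 _ k0; exists x.
have [f fP] := choice exf.
have Vf k : V (f k) by apply: (svalP (S k)).1; exact: (fP k).1.
(* Colour classes need not be convex, so minimal norm is sought in intersections of [b]-balls around
   the [f j]. These contain [f k], since [f j] and [f k] both lie in the piece [S j], whose diameter
   is controlled. *)
pose C k := [set g | V g /\ forall j, (j <= k)%N ->
  b (g - f j) (g - f j) <= natSinv j].
have [g [Cg cg _]] : exists x, [/\ forall k, C k (x k),
    cauchy (fun z => a z z) x &
    forall k y, C k y -> a (x k) (x k) <= a y y + natSinv k].
  apply: (@nested_minimizers (fun z => a z z) (fun z => a z z) C 0 M).
  - by move=> j k jk g [Vg gf]; split=> // i ij; apply: gf; exact: leq_trans jk.
  - move=> k; exists (f k); last exact/bV/Vf.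
    split=> [|j jk]; first exact: Vf.
    by apply: Sd; [apply: ndS jk _ _|]; exact: (fP _).1.
  - by move=> x [Vx _]; apply: (semi_inner_ge0 ha); exact: VD.
  - move=> k x y [Vx xf] [Vy yf]; split; first exact: midV.
    move=> j jk; have := xf _ jk; have := yf _ jk.
    have DB z : V z -> D (z - f j).
      by move=> Vz; apply: (subspaceB sD); apply: VD.
    have -> : 2^-1 *: (x + y) - f j = 2^-1 *: ((x - f j) + (y - f j)).
      rewrite addrACA -opprD scalerBr; congr (_ - _).
      by rewrite -mulr2n -(scaler_nat _ (f j)) scalerA mulVf ?scale1r// pnatr_eq0.
    rewrite (semi_inner_sq_half sD hb); [|exact: DB|exact: DB].
    have := semi_inner_ge0 hb (subspaceB sD (DB _ Vx) (DB _ Vy)); lra.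
  - by move=> x y [Vx _] [Vy _]; apply: (semi_inner_sq_half sD ha); exact: VD.
have Vg k : V (g k) := (Cg k).1.
have [y Dy gy] := cD _ (fun k => VD _ (Vg k)) cg.
exists y; first exact: clV Vg Dy gy.
(* Pass through [g k] with [k] beyond both [N] and [j]: it is [b]-close to [f j] as a member of
   [C k], and to [y] through [bK]. Each squared distance is at most [natSinv j], and the squared
   triangle inequality doubles both. *)
have byf j : b (f j - y) (f j - y) <= 4 * natSinv j.
  have ej : 0 < natSinv j / K :> R by rewrite divr_gt0// natSinv_gt0.
  have [N gN] := gy _ ej; pose k := maxn N j.
  have Dfg : D (f j - g k) by apply: (subspaceB sD); exact: VD.
  have Dgy : D (g k - y) by apply: (subspaceB sD) => //; exact: VD.
  have -> : f j - y = (f j - g k) + (g k - y) by rewrite addrA subrK.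
  apply: le_trans (semi_inner_sqD_le sD hb Dfg Dgy) _.
  have := (Cg k).2 j (leq_maxr _ _).
  have := bK _ Dgy; have := gN k (leq_maxl _ _).
  rewrite -(ler_pM2l K0) mulrCA divff ?gt_eqF// mulr1.
  rewrite (semi_inner_sqBC sD hb (VD _ (Vg k)) (VD _ (Vf j))).
  lra.
move=> z Vz; apply: le_trans (bs _ Vz) _.
apply/ler_addgt0Pr => e e0.
have by0 : 0 <= b y y := semi_inner_ge0 hb Dy.
(* [h] makes the loss [h * b y y] at most [e / 2]. The constant [c] collects the other errors:
   [natSinv j] from the choice of [f j], and [(1 + h^-1) * 4 * natSinv j] from [byf]. *)
pose h := e / 2 / (b y y + 1).
have h0 : 0 < h by rewrite !divr_gt0//; lra.
pose c := 4 * (1 + h^-1) + 1.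
have hi0 : 0 < h^-1 by rewrite invr_gt0.
have c0 : 0 < c by rewrite /c; lra.
have [j] : exists j, natSinv j <= e / 2 / c by apply: ex_natSinv_le; rewrite !divr_gt0.
rewrite ler_pdivlMr// => jc.
have Dfy : D (f j - y) by apply: (subspaceB sD) => //; exact: VD.
have := semi_inner_peter_paul sD hb h0 Dy Dfy; rewrite [y + _]addrC subrK.
have := (fP j).2; have := byf j.
have hby : h * b y y <= e / 2.
  by rewrite /h mulrAC ler_pdivrMr ?ler_pM2l//; lra.
have i0 : 0 < 1 + h^-1 by rewrite addr_gt0// invr_gt0.
rewrite -(ler_pM2l i0); move: jc; rewrite /c; lra.
Qed.

End semi_inner.

(** * Completeness of L^2 *)

Lemma bounded_onP {R : realType} T (A : set T) (f : T -> R) (M : R) :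
  (forall x, A x -> `|f x| <= M) -> [bounded f x | x in A].
Proof.
move=> fM; rewrite /bounded_near; near=> K => x Ax /=.
rewrite (le_trans (fM _ Ax))//; near: K; exact/nbhs_pinfty_ge/num_real.
Unshelve. all: by end_near. Qed.

Section square_integrable.
Context d (T : measurableType d) (R : realType) (mu : {measure set T -> \bar R}).
Implicit Types f g h : T -> R.

(** [sqint] and [ip] are [L2] and [inner] over an arbitrary measure, so that results transfer to the
    latter by conversion. *)
Definition sqint : set (T -> R) := [set f | f \in Lfun mu 2%:E].

Definition ip f g : R := \int[mu]_x (f x * g x).

Lemma sqintP f : sqint f <->
  measurable_fun setT f /\ mu.-integrable setT (EFin \o (fun x => f x * f x)).
Proof.
split=> [Lf|[mf /integrableP[_ fi]]].
  split; last exact: (Lfun1_integrable _ _).1 (Lfun2_mul_Lfun1 Lf Lf).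
  by have := Lf; rewrite /sqint/= inE => /andP[/[!inE]].
rewrite /sqint/= inE; apply/andP; split; rewrite inE//=.
rewrite /finite_norm unlock poweR_lty//; apply: le_lt_trans fi.
rewrite le_eqVlt; apply/orP; left; apply/eqP; apply: eq_integral => x _ /=.
by rewrite normrM -expr2 powR_mulrn// normr_ge0.
Qed.

Lemma sqint_measurable f : sqint f -> measurable_fun setT f.
Proof. by move=> /sqintP[]. Qed.

Lemma sqintM f g : sqint f -> sqint g ->
  mu.-integrable setT (EFin \o (fun x => f x * g x)).
Proof. by move=> Lf Lg; exact: (Lfun1_integrable _ _).1 (Lfun2_mul_Lfun1 Lf Lg). Qed.

Lemma sqint_subspace : subspace sqint.
Proof.
have h : (1 <= 2%:E :> \bar R)%E by rewrite lee_fin ler1n.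
have [? H] := Lfun_submod_closed mu h.
by split=> // k x y Lx Ly; have := H k x y Lx Ly.
Qed.

Lemma semi_inner_ip : semi_inner sqint ip.
Proof.
split.
- by move=> f g _ _; apply: eq_Rintegral => x _; rewrite mulrC.
- move=> k f g h Lf Lg Lh.
  rewrite /ip -RintegralZl//; last exact: sqintM.
  rewrite -RintegralD//; last exact: sqintM.
    by apply: eq_Rintegral => x _; rewrite !fctE mulrDl mulrA.
  apply: eq_integrable (integrableZl measurableT k (sqintM Lf Lh)) => //.
- by move=> f _; apply: Rintegral_ge0 => x _; rewrite -expr2 sqr_ge0.
Qed.

Lemma ipE f g : sqint f -> sqint g ->
  (ip f g)%:E = (\int[mu]_x (f x * g x)%:E)%E.
Proof.
by move=> Lf Lg; rewrite fineK//; exact: integrable_fin_num (sqintM Lf Lg).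
Qed.

Lemma sqint_le f g : measurable_fun setT f -> sqint g ->
  {ae mu, forall x, `|f x| <= `|g x|} -> sqint f /\ ip f f <= ip g g.
Proof.
move=> mf Lg fg.
have mff : measurable_fun setT (fun x => f x * f x) by exact: measurable_funM.
have mgg : measurable_fun setT (fun x => g x * g x).
  by apply: measurable_funM; exact: sqint_measurable.
have H : (\int[mu]_x (f x * f x)%:E <= \int[mu]_x (g x * g x)%:E)%E.
  apply: ae_ge0_le_integral => //.
  - by move=> x _; rewrite lee_fin -expr2 sqr_ge0.
  - exact/measurable_EFinP.
  - by move=> x _; rewrite lee_fin -expr2 sqr_ge0.
  - exact/measurable_EFinP.
  apply: filterS fg => x fg _; rewrite lee_fin -!expr2 -[leLHS]real_normK ?num_real//.
  by rewrite -[leRHS]real_normK ?num_real// lerXn2r// nnegrE.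
have Lf : sqint f.
  apply/sqintP; split=> //; apply/integrableP; split; first exact/measurable_EFinP.
  have /integrableP[_] := sqintM Lg Lg; apply: le_lt_trans.
  rewrite (eq_integral (fun x => (f x * f x)%:E)); last first.
    by move=> x _ /=; rewrite ger0_norm// -expr2 sqr_ge0.
  apply: le_trans H _; rewrite le_eqVlt; apply/orP; left; apply/eqP.
  by apply: eq_integral => x _ /=; rewrite ger0_norm// -expr2 sqr_ge0.
by split=> //; rewrite -lee_fin !ipE.
Qed.

Lemma ip_eq0 f : sqint f -> ip f f = 0 -> {ae mu, forall x, f x = 0}.
Proof.
move=> Lf f0.
have mff : measurable_fun setT (fun x => (f x * f x)%:E).
  by apply/measurable_EFinP/measurable_funM; exact: sqint_measurable.
have : (\int[mu]_x `|(f x * f x)%:E| = 0)%E.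
  rewrite -[RHS]/(0%:E) -f0 ipE//; apply: eq_integral => x _ /=.
  by rewrite ger0_norm// -expr2 sqr_ge0.
move/(ae_eq_integral_abs mu measurableT mff); apply: filterS => x /(_ I)/= [].
by move/eqP; rewrite mulf_eq0 orbb => /eqP.
Qed.

Context (mu_lty : (mu setT < +oo)%E).

Lemma sqint_cst c : sqint (cst c).
Proof.
apply/sqintP; split; first exact: measurable_cst.
apply: measurable_bounded_integrable => //; first exact: measurable_funM.
by apply: (@bounded_onP _ _ _ _ `|c * c|).
Qed.

Lemma sqint_bounded f M : measurable_fun setT f ->
  {ae mu, forall x, `|f x| <= M} -> sqint f.
Proof.
move=> mf fM; apply: (sqint_le mf (sqint_cst M) _).1.
by apply: filterS fM => x fM; exact: le_trans (ler_norm _).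
Qed.

Lemma sqint_integrable f : sqint f -> mu.-integrable setT (EFin \o f).
Proof.
move=> Lf; apply: eq_integrable (sqintM Lf (sqint_cst 1)) => //.
by move=> x _ /=; rewrite mulr1.
Qed.

(* AM-GM: [|z| <= (r + z^2 / r) / 2]. *)
Lemma sqint_norm_le f r : sqint f -> 0 < r ->
  \int[mu]_x `|f x| <= 2^-1 * r * fine (mu setT) + 2^-1 / r * ip f f.
Proof.
move=> Lf r0; have If := integrable_norm (sqint_integrable Lf).
have Iff := sqintM Lf Lf.
have Ic : mu.-integrable setT (EFin \o (fun=> 2^-1 * r)).
  by apply: sqint_integrable; exact: sqint_cst.
have Iz : mu.-integrable setT (EFin \o (fun x => 2^-1 / r * (f x * f x))).
  by apply: eq_integrable (integrableZl measurableT (2^-1 / r) Iff).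
rewrite -Rintegral_cst// /ip -RintegralZl// -RintegralD//.
apply: le_Rintegral => //; first by apply: eq_integrable (integrableD _ Ic Iz).
move=> x _; rewrite -subr_ge0.
have -> : 2^-1 * r + 2^-1 / r * (f x * f x) - `|f x| = 2^-1 / r * (r - `|f x|) ^+ 2.
  by rewrite -expr2 -(real_normK (num_real (f x))); field; rewrite gt_eqF.
by rewrite mulr_ge0 ?sqr_ge0// divr_ge0// ltW.
Qed.

Lemma summable_increments_cvg (y : nat -> R) :
  (\sum_(0 <= k <oo) `|y k.+1 - y k|%:E < +oo)%E -> cvgn y.
Proof.
move=> yoo; have cs : cvgn (series (telescope y)).
  apply: normed_cvg; apply: (@nnseries_is_cvg _ (fun k => `|telescope y k|)) => //.
have -> : y = (fun n => y 0%N + series (telescope y) n).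
  apply/funext => n; rewrite seriesEnat/= telescope_sumr// addrC subrK//.
by apply: is_cvgD => //; exact: is_cvg_cst.
Qed.

(** Riesz-Fischer. A subsequence [y] has increments of norm at most [2^-k]; as the measure is
    finite, they are summable in L^1, so [y] converges almost everywhere. Fatou's lemma then turns
    pointwise convergence into convergence in L^2. *)
Lemma sqint_complete (x : nat -> T -> R) : (forall k, sqint (x k)) ->
  cauchy (fun z => ip z z) x ->
  exists2 y, sqint y & limit (fun z => ip z z) x y.
Proof.
move=> Lx cx; have sS := sqint_subspace; have sip := semi_inner_ip.
have LB f g : sqint f -> sqint g -> sqint (f - g) by exact: subspaceB.
pose r k : R := 2^-1 ^+ k.
have r0 k : 0 < r k by rewrite exprn_gt0// invr_gt0.
have [N NP] := choice (fun k => cx (r k ^+ 2) (exprn_gt0 _ (r0 k))).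
(* Partial sums make the indices monotone and keep [n k] above the threshold [N k]. *)
pose n k := (\sum_(i < k.+1) N i)%N.
have Nn k : (N k <= n k)%N by rewrite /n big_ord_recr/= leq_addl.
have nS k : (n k <= n k.+1)%N by rewrite /n [in leqRHS]big_ord_recr/= leq_addr.
have nd j k : (j <= k)%N -> (n j <= n k)%N.
  by move/subnK <-; elim: (k - j)%N => // i IH; rewrite addSn; exact: leq_trans (nS _).
pose y k := x (n k).
have Ly k : sqint (y k) by exact: Lx.
have yP j k : (j <= k)%N -> ip (y k - y j) (y k - y j) <= r j ^+ 2.
  by move=> jk; apply: NP => //; apply: leq_trans (Nn j) (nd _ _ jk).
have mfn f : sqint f -> measurable_fun setT (fun t => `|f t|%:E).
  move=> Lf; apply/measurable_EFinP; apply: measurableT_comp => //.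
  exact: sqint_measurable.
have cv : {ae mu, forall t, cvgn (y ^~ t)}.
  pose S t := (\sum_(0 <= k <oo) `|(y k.+1 - y k) t|%:E)%E.
  have mS : measurable_fun setT S.
    apply: ge0_emeasurable_sum => [k t _ _|k _ _]; first by rewrite lee_fin.
    exact: (mfn _ (LB _ _ (Ly k.+1) (Ly k))).
  have : mu.-integrable setT S.
    apply/integrableP; split=> //.
    rewrite (eq_integral S); last first.
      by move=> t _; rewrite gee0_abs//; apply: nneseries_ge0 => k _ _; rewrite lee_fin.
    rewrite integral_nneseries//; last first.
      by move=> k; exact: (mfn _ (LB _ _ (Ly k.+1) (Ly k))).
    (* [sqint_norm_le] with the parameter [r k], applied to an increment of squared norm at most
       [r k ^+ 2], gives exactly [c * r k]. *)
    pose c := 2^-1 * (fine (mu setT) + 1).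
    apply: (@le_lt_trans _ _ (\sum_(0 <= k <oo) (geometric c (2^-1) k)%:E)%E).
      apply: lee_nneseries => [k _ _|k _]; first exact: integral_ge0.
      have Lz : sqint (y k.+1 - y k) by exact: LB.
      have Iz := integrable_norm (sqint_integrable Lz).
      rewrite -[leLHS]fineK; last exact: integrable_fin_num Iz.
      rewrite lee_fin; apply: le_trans (sqint_norm_le Lz (r0 k)) _.
      have zr : 2^-1 / r k * ip (y k.+1 - y k) (y k.+1 - y k) <= 2^-1 / r k * r k ^+ 2.
        by rewrite ler_pM2l ?divr_gt0//; exact: yP.
      apply: le_trans (lerD (lexx _) zr) _.
      rewrite le_eqVlt; apply/orP; left; apply/eqP.
      by rewrite /geometric/= -/(r k) /c; field; rewrite gt_eqF.
    have cg : cvgn (series (geometric c (2^-1 : R))).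
      by apply: is_cvg_geometric_series; rewrite ger0_norm ?invf_lt1// ?ltr1n// invr_ge0.
    rewrite (_ : (fun k => _) = eseries (EFin \o geometric c (2^-1 : R))); last first.
      by apply/funext => k.
    rewrite (_ : eseries _ = EFin \o series (geometric c (2^-1 : R))); last first.
      by apply/funext => k /=; rewrite /eseries/= sumEFin.
    by rewrite EFin_lim// ltry.
  move/(integrable_ae measurableT); apply: filterS => t /(_ I).
  rewrite fin_numE => /andP[_ St]; apply: summable_increments_cvg.
  by rewrite ltey.
(* The upper limit exists at every point, so [f] is measurable whatever happens on the null set
   where [y] diverges. *)
pose f t := fine (limn_esup (fun k => (y k t)%:E)).
have mf : measurable_fun setT f.
  apply: measurableT_comp => //; apply: measurable_fun_limn_esup => k.
  by apply/measurable_EFinP; exact: sqint_measurable.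
have fP : {ae mu, forall t, y ^~ t @ \oo --> f t}.
  apply: filterS cv => t ct.
  have : (fun k => (y k t)%:E) @ \oo --> (limn (y ^~ t))%:E.
    by apply: cvg_EFin => //; exact: nearW.
  by move/cvg_limn_einf_sup => [_ h]; rewrite /f h.
(* Fatou's lemma for fixed [j]: almost everywhere the integrand on the left is the lower limit in
   [k] of the squares of [y k - y j]. *)
have key j : (\int[mu]_t ((f - y j) t * (f - y j) t)%:E <= (r j ^+ 2)%:E)%E.
  have mz k : measurable_fun setT (fun t => ((y k - y j) t * (y k - y j) t)%:E).
    apply/measurable_EFinP.
    by apply: measurable_funM; apply: sqint_measurable; exact: LB.
  have z0 k t : (0 <= ((y k - y j) t * (y k - y j) t)%:E)%E.
    by rewrite lee_fin -expr2 sqr_ge0.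
  have mlim : measurable_fun setT (fun t => limn_einf
      (fun k => ((y k - y j) t * (y k - y j) t)%:E)).
    rewrite (_ : (fun t => _) = (fun t => - limn_esup
        (fun k => - ((y k - y j) t * (y k - y j) t)%:E))%E); last first.
      apply/funext => t; rewrite -[RHS]limn_einfN; congr limn_einf.
      by apply/funext => k; rewrite /comp -!EFinN opprK.
    apply: measurableT_comp => //; apply: measurable_fun_limn_esup => k.
    exact: measurableT_comp.
  have mfy : measurable_fun setT (f - y j).
    by apply: measurable_funB => //; exact: sqint_measurable.
  apply: le_trans (_ : (_ <= \int[mu]_t limn_einf
      (fun k => ((y k - y j) t * (y k - y j) t)%:E))%E) _.
    rewrite le_eqVlt; apply/orP; left; apply/eqP; apply: ge0_ae_eq_integral => //.
    - by apply/measurable_EFinP/measurable_funM.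
    - by move=> t _; rewrite lee_fin -expr2 sqr_ge0.
    - move=> t _; rewrite limn_einf_lim; apply: lime_ge; first exact: is_cvg_einfs.
      by apply: nearW => k; apply: le_ereal_inf_tmp => _ [i _ <-]; exact: z0.
    apply: filterS fP => t ft _; apply/esym; apply: (cvg_limn_einf_sup _).1.
    apply: cvg_EFin; first exact: nearW.
    by apply: cvgM; apply: cvgB => //; exact: cvg_cst.
  apply: le_trans (fatou mu measurableT mz (fun k t _ => z0 k t)) _.
  rewrite limn_einf_lim; apply: lime_le; first exact: is_cvg_einfs.
  apply: nearW => k; apply: le_trans (ereal_inf_lbound _) _.
    by exists (maxn j k) => //=; exact: leq_maxr.
  by rewrite -ipE; [rewrite lee_fin; apply: yP; exact: leq_maxl|exact: LB|exact: LB].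
have Lfy j : sqint (f - y j).
  apply/sqintP; split; first by apply: measurable_funB => //; exact: sqint_measurable.
  apply/integrableP; split.
    apply/measurable_EFinP; apply: measurable_funM;
    by apply: measurable_funB => //; exact: sqint_measurable.
  apply: le_lt_trans (ltry (r j ^+ 2)); apply: le_trans (key j).
  rewrite le_eqVlt; apply/orP; left; apply/eqP.
  by apply: eq_integral => t _ /=; rewrite ger0_norm// -expr2 sqr_ge0.
have Lf : sqint f.
  have -> : f = (f - y 0%N) + y 0%N by rewrite subrK.
  exact: subspaceD.
exists f => // e e0.
have [j je] : exists j, r j ^+ 2 <= e / 4.
  have : (fun j => r j) @ \oo --> (0 : R).
    rewrite (_ : (fun j => r j) = geometric 1 2^-1); last first.
      by apply/funext => j; rewrite /geometric/= mul1r.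
    by apply: cvg_geometric; rewrite ger0_norm ?invf_lt1// ?ltr1n// invr_ge0.
  (* The bound by 1 gives [r j ^+ 2 <= r j]; the fraction [e / 4] compensates for the doubling in
     [semi_inner_sqD_le], used on two terms. *)
  have e4 : 0 < Num.min 1 (e / 4) by rewrite lt_min ltr01/= divr_gt0.
  move=> /cvgr0Pnorm_lt/(_ _ e4)[j _ /(_ j (leqnn j))]; rewrite /= lt_min.
  rewrite ger0_norm ?ltW// => /andP[r1 re]; exists j.
  by apply: le_trans (ltW re); rewrite expr2 ger_pMl// ltW.
exists (n j) => k jk.
have -> : x k - f = (x k - y j) + (y j - f) by rewrite addrA subrK.
have Lyf : sqint (y j - f) by exact: LB.
apply: le_trans (semi_inner_sqD_le sS sip (LB _ _ (Lx k) (Ly j)) Lyf) _.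
have h1 : ip (x k - y j) (x k - y j) <= r j ^+ 2.
  by apply: NP => //; exact: leq_trans jk.
have h2 : ip (y j - f) (y j - f) <= r j ^+ 2.
  rewrite -(opprB f) -(scaleN1r (f - y j)) (semi_inner_sqZ sS sip)//.
  by rewrite sqrrN expr1n mul1r -lee_fin ipE.
lra.
Qed.

End square_integrable.

(** * Translations and directional derivatives *)

(** The image of the measure under a translation has the right values on half-open intervals, and
    these determine it. *)
Lemma lebesgue_measure_shift {R : realType} (a : R) (A : set (measurableTypeR R)) :
  measurable A -> lebesgue_measure ((fun x => x + a) @^-1` A) = lebesgue_measure A.
Proof.
move=> mA.
have mS : measurable_fun setT (fun x : measurableTypeR R => x + a : measurableTypeR R).
  by apply: measurable_funD => //; exact: measurable_id.
pose m := measure_function_pushforward__canonical__measure_function_Measure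
  (@lebesgue_measure R) mS.
apply/esym; apply: (@lebesgue_measure_unique _ m) => // _ [[u v]] _ <-.
rewrite /m/= /pushforward.
have -> : (fun x => x + a) @^-1` `]u, v]%classic = `]u - a, v - a]%classic.
  by apply/seteqP; split => x /=; rewrite !in_itv/= ltrBlDr lerBrDr.
rewrite !lebesgue_measure_itv/= !lte_fin ltrD2r; case: ifP => // _.
by rewrite -!EFinD; congr EFin; ring.
Qed.

Section translation.
Context {R : realType}.

Lemma measurable_rV_add n d (T : measurableType d) (f g : T -> 'rV[R]_n) :
  measurable_fun setT f -> measurable_fun setT g ->
  measurable_fun setT (fun x => f x + g x).
Proof.
move=> mf mg; apply: measurable_fun_rVP => i.
under eq_fun do rewrite mxE.
by apply: measurable_funD;
  [exact: (measurableT_comp (measurable_rV_coord i) mf)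
  |exact: (measurableT_comp (measurable_rV_coord i) mg)].
Qed.

Lemma measurable_shift_rV n (h : 'rV[R]_n) :
  measurable_fun setT (fun x : 'rV[R]_n => x + h).
Proof. by apply: measurable_rV_add; [exact: measurable_id|exact: measurable_cst]. Qed.

(** Through [row_cons] the translation acts separately on the first coordinate and on the rest. On
    rectangles the claim is the one-dimensional case times the induction hypothesis, and rectangles
    determine the product measure. *)
Lemma lebesgue_rV_shift n (h : 'rV[R]_n) (A : set 'rV[R]_n) : measurable A ->
  lebesgue_rV n ((fun x => x + h) @^-1` A) = lebesgue_rV n A.
Proof.
elim: n h A => [|n IH] h A mA.
  congr (lebesgue_rV 0 _); apply/seteqP; split => x /=;
    by rewrite (_ : x + h = x)//; apply/rowP; case.
pose h' : 'rV[R]_n := \row_i h ord0 (lift ord0 i).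
pose S (p : measurableTypeR R * 'rV[R]_n) : measurableTypeR R * 'rV[R]_n :=
  (p.1 + h ord0 ord0, p.2 + h').
have mS : measurable_fun setT S.
  apply/measurable_fun_pairP; split=> /=.
    by apply: measurable_funD; [exact: measurable_fst|exact: measurable_cst].
  exact: (measurableT_comp (measurable_shift_rV h') measurable_snd).
rewrite -[LHS]/((lebesgue_measure \x lebesgue_rV n)%E (@row_cons R n @^-1` _)).
rewrite -[RHS]/((lebesgue_measure \x lebesgue_rV n)%E (@row_cons R n @^-1` _)).
pose m := measure_function_pushforward__canonical__measure_function_Measure
  (lebesgue_measure \x lebesgue_rV n)%E mS.
have mB : measurable (@row_cons R n @^-1` A).
  by rewrite -[X in measurable X]setTI; exact: measurable_row_cons.
rewrite [RHS](@product_measure_unique _ _ _ _ _ _ _ m)//.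
  rewrite /m/= /pushforward; congr (_ _); apply/seteqP.
  suff E p : row_cons p + h = row_cons (S p) by split => p /=; rewrite E.
  apply/rowP => i; rewrite !mxE; case: unliftP => [j ->|->] //=.
  by rewrite !mxE.
move=> X Y mX mY; rewrite /m/= /pushforward.
rewrite (_ : _ @^-1` _ = ((fun x => x + h ord0 ord0) @^-1` X) `*`
    ((fun x => x + h') @^-1` Y))//.
have mX' : measurable ((fun x => x + h ord0 ord0) @^-1` X).
  have m1 : measurable_fun setT (fun x : measurableTypeR R => x + h ord0 ord0).
    by apply: measurable_funD => //; exact: measurable_id.
  by rewrite -[X in measurable X]setTI; exact: m1.
have mY' : measurable ((fun x => x + h') @^-1` Y).
  by rewrite -[X in measurable X]setTI; exact: measurable_shift_rV.
by rewrite product_measure1E//; congr (_ * _)%E; [exact: lebesgue_measure_shift|exact: IH].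
Qed.

Lemma ge0_integral_shift n (h : 'rV[R]_n) (f : 'rV[R]_n -> \bar R) :
  measurable_fun setT f -> (forall x, 0 <= f x)%E ->
  (\int[lebesgue_rV n]_x f (x + h)%R = \int[lebesgue_rV n]_x f x)%E.
Proof.
move=> mf f0.
pose m := measure_function_pushforward__canonical__measure_function_Measure
  (lebesgue_rV n) (measurable_shift_rV h).
transitivity (\int[m]_x f x)%E.
  by rewrite [RHS]ge0_integral_pushforward//; exact: measurable_shift_rV.
by apply: eq_measure_integral => A mA _; rewrite /m/= /pushforward lebesgue_rV_shift.
Qed.

End translation.

Section directional.
Context {R : realType} {n : nat}.
Implicit Types (F G : 'rV[R]_n -> R) (e x : 'rV[R]_n).
Local Notation lambda := (lebesgue_rV n).

Lemma continuous_measurable_rV F : continuous F -> measurable_fun setT F.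
Proof.
move=> /continuousP cF; apply: (measurability _ (RGenOpens.measurableE R)).
move=> _ [_ [a [b ->] <-]]; rewrite setTI; apply: open_measurable_rV.
exact/cF/interval_open.
Qed.

(** The norm of row vectors is the maximum norm, so balls are cubes and [lebesgue_rV_box] measures
    them. *)
Lemma mx_norm_leP x (M : R) : 0 <= M -> reflect (forall i, `|x ord0 i| <= M) (`|x| <= M).
Proof.
move=> M0; apply: (iffP idP) => [xM i|xM].
  apply: le_trans xM; rewrite [leRHS]mx_normrE.
  exact: (@le_bigmax _ _ _ 0 (fun ij : 'I_1 * 'I_n => `|x ij.1 ij.2|) (ord0, i)).
by rewrite [leLHS]mx_normrE; apply/bigmax_leP; split=> // -[i j] _; rewrite [i]ord1.
Qed.

Lemma lebesgue_rV_ball_lty (M : R) : (lambda [set x | `|x| <= M]%R < +oo)%E.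
Proof.
have [M0|M0] := ltP M 0.
  rewrite (_ : [set x | _] = set0) ?measure0//; apply/seteqP; split=> // x /= xM.
  by have := le_lt_trans xM M0; rewrite ltNge normr_ge0.
rewrite (_ : [set x | _] = [set x : 'rV_n | forall i, `[- M, M]%classic (x ord0 i)]).
  rewrite (@lebesgue_rV_box R n (fun=> `[- M, M]%classic)); last first.
    by move=> i; exact: measurable_itv.
  set I := `[- M, M]%classic.
  suff : (0 <= \prod_(i < n) lebesgue_measure I < +oo)%E by case/andP.
  apply: (big_ind (fun z => (0 <= z < +oo)%E)); first by rewrite lee_fin ler01 ltry.
    move=> y z /andP[y0 yo] /andP[z0 zo]; rewrite mule_ge0//=.
    by rewrite lte_mul_pinfty// ge0_fin_numE.
  move=> i _; rewrite measure_ge0/=.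
  by apply: compact_finite_measure; exact: segment_compact.
apply/seteqP; split => x /=.
  by move/(mx_norm_leP _ M0) => h i; rewrite in_itv/= -ler_norml.
by move=> h; apply/(mx_norm_leP _ M0) => i; rewrite ler_norml; have := h i; rewrite in_itv.
Qed.

Lemma measurable_rV_ball (M : R) : measurable [set x : 'rV[R]_n | `|x| <= M].
Proof.
rewrite -[X in measurable X]setCK; apply: measurableC; apply: open_measurable_rV.
rewrite openC; apply: (@preimage_closed _ _ (fun x : 'rV[R]_n => `|x|) [set y | y <= M]).
  by move=> x _; exact: norm_continuous.
exact: closed_le.
Qed.

(** Regularity is asked along the single direction [e], which is all that difference quotients see.
    Products of test functions thus qualify by the Leibniz rule for one derivative. *)
Definition C1c e F := [/\ continuous F, forall x, derivable F x e,
  continuous ('D_e F) & exists M, forall x, M < `|x| -> F x = 0].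

Lemma bounded_of_support F (M : R) : continuous F ->
  (forall x, M < `|x| -> F x = 0) -> exists2 K, 0 <= K & forall x, `|F x| <= K.
Proof.
move=> cF F0.
have cB : compact [set x : 'rV[R]_n | `|x| <= M].
  apply: bounded_closed_compact.
    by exists M; split; [exact: num_real|move=> N MN x /= xM; exact: le_trans xM (ltW MN)].
  apply: (@preimage_closed _ _ (fun x : 'rV[R]_n => `|x|) [set y | y <= M]).
    by move=> x _; exact: norm_continuous.
  exact: closed_le.
have /compact_bounded[K [_ HK]] : compact (F @` [set x : 'rV[R]_n | `|x| <= M]).
  by apply: continuous_compact => //; exact: continuous_subspaceT.
have K1 : K < `|K| + 1 by rewrite (le_lt_trans (ler_norm _))// ltrDl.
exists (`|K| + 1); first by rewrite addr_ge0.
move=> x; have [xM|Mx] := leP `|x| M; first by apply: (HK _ K1); exists x.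
by rewrite F0// normr0 addr_ge0.
Qed.

Lemma derive_eq0 e F (M : R) x : (forall x, M < `|x| -> F x = 0) -> M < `|x| ->
  'D_e F x = 0.
Proof.
move=> F0 Mx; rewrite -(derive_cst (0 : R) x e); apply: near_eq_derive.
have : \forall y \near x, M < `|y|.
  exact: (cvgr_gt _ (@norm_continuous _ _ x)).
by apply: filterS => y /F0.
Qed.

Lemma is_derive_line e F : (forall x, derivable F x e) ->
  forall x (s : R), is_derive s 1 (fun s : R => F (x + s *: e)) ('D_e F (x + s *: e)).
Proof.
move=> dF x s.
have E : (fun h : R => h^-1 *: (((fun s => F (x + s *: e)) \o shift s) (h *: 1)
             - F (x + s *: e))) =
         (fun h => h^-1 *: ((F \o shift (x + s *: e)) (h *: e) - F (x + s *: e))).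
  apply/funext => h; congr (_ *: (F _ - _)).
  by rewrite /= -[h *: 1]/(h * 1) mulr1 scalerDl addrCA.
split; first by rewrite /derivable E; exact: dF.
by rewrite /derive E.
Qed.

Lemma increment_le e F (K : R) : (forall x, derivable F x e) ->
  (forall x, `|'D_e F x| <= K) ->
  forall x (s : R), `|F (x + s *: e) - F x| <= K * `|s|.
Proof.
move=> dF FK x s; pose g s := F (x + s *: e).
have dg := is_derive_line dF x.
have cg a b : {within `[a, b], continuous g}.
  apply: derivable_within_continuous => y _; exact: ex_derive.
have g0 : F x = g 0 by rewrite /g scale0r addr0.
have [s0|s0] := leP 0 s.
  have [c _] := MVT_segment s0 (fun y _ => dg y) (cg _ _).
  rewrite subr0 -/(g s) g0 => ->; rewrite normrM.
  by rewrite ler_wpM2r.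
have [c _] := MVT_segment (ltW s0) (fun y _ => dg y) (cg _ _).
rewrite sub0r -/(g s) g0 distrC => ->; rewrite normrM normrN.
by rewrite ler_wpM2r.
Qed.

Lemma cvg_dnbhs (u : nat -> R) : u @ \oo --> (0 : R) -> (forall k, u k != 0) ->
  u @ \oo --> (0 : R)^'.
Proof. by move=> u0 un A /u0 h; apply: (@filterS _ \oo _ _ _ _ h) => k /=; apply; exact: un. Qed.

(** The increment is multiplied by the number of steps and not divided by the step, so that [h = 0]
    is allowed. *)
Lemma difference_quotient_cvg e F (h : R) x : derivable F x e ->
  (fun k : nat => k.+1%:R * (F (x + (h * natSinv k) *: e) - F x)) @ \oo --> h * 'D_e F x.
Proof.
move=> dF; have [->|h0] := eqVneq h 0.
  rewrite mul0r (_ : (fun k : nat => _) = cst 0); first exact: cvg_cst.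
  by apply/funext => k; rewrite mul0r scale0r addr0 subrr mulr0.
have u0 : (fun k : nat => h * natSinv k) @ \oo --> (0 : R).
  rewrite -[X in _ --> X](mulr0 h); apply: cvgM; first exact: cvg_cst.
  exact: cvg_harmonic.
have un k : h * natSinv k != 0 by rewrite mulf_neq0// gt_eqF// natSinv_gt0.
have H : (fun k => (h * natSinv k)^-1 * ((F \o shift x) ((h * natSinv k) *: e) - F x))
    @ \oo --> 'D_e F x.
  exact: (cvg_comp _ _ (cvg_dnbhs u0 un) dF).
rewrite (_ : (fun k : nat => _) = (fun k => h *
    ((h * natSinv k)^-1 * ((F \o shift x) ((h * natSinv k) *: e) - F x)))).
  by apply: cvgM => //; exact: cvg_cst.
apply/funext => k /=; rewrite [RHS]mulrA [X in F X]addrC; congr (_ * _).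
by rewrite invfM mulrA divff// mul1r invrK.
Qed.

Lemma integral_shift (v : 'rV[R]_n) (f : 'rV[R]_n -> \bar R) :
  measurable_fun setT f ->
  (\int[lambda]_x f (x + v)%R = \int[lambda]_x f x)%E.
Proof.
move=> mf; rewrite integralE [RHS]integralE.
congr (_ - _)%E.
  rewrite -[RHS](ge0_integral_shift v (measurable_funepos mf) (funepos_ge0 f)).
  by apply: eq_integral => x _; rewrite !funeposE.
rewrite -[RHS](ge0_integral_shift v (measurable_funeneg mf) (funeneg_ge0 f)).
by apply: eq_integral => x _; rewrite !funenegE.
Qed.

Lemma integrable_bounded_support F (K M : R) : measurable_fun setT F ->
  (forall x, `|F x| <= K) -> (forall x, M < `|x| -> F x = 0) ->
  lambda.-integrable setT (EFin \o F).
Proof.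
move=> mF FK F0; have mB := measurable_rV_ball M.
have -> : EFin \o F = (EFin \o F) \_ [set x | `|x| <= M]%R.
  apply/funext => x; rewrite patchE; case: ifPn => //.
  by rewrite notin_setE/= => /negP; rewrite -ltNge => /F0 /= ->.
rewrite -integrable_mkcond//; apply: measurable_bounded_integrable => //.
- exact: lebesgue_rV_ball_lty.
- exact: measurable_funTS.
- by apply: (@bounded_onP _ _ _ _ K).
Qed.

Section C1c.
Context (e : 'rV[R]_n) (F : 'rV[R]_n -> R) (HF : C1c e F).

Let cF : continuous F. Proof. by case: HF. Qed.
Let dF x : derivable F x e. Proof. by case: HF. Qed.
Let cD : continuous ('D_e F). Proof. by case: HF. Qed.

Lemma C1c_integrable : lambda.-integrable setT (EFin \o F).
Proof.
case: HF => _ _ _ [M F0]; have [K K0 FK] := bounded_of_support cF F0.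
exact: integrable_bounded_support (continuous_measurable_rV cF) FK F0.
Qed.

Let q (h : R) (k : nat) x := k.+1%:R * (F (x + (h * natSinv k) *: e) - F x).

Let mshift (v : 'rV[R]_n) : measurable_fun setT (fun x => F (x + v)).
Proof.
exact: (measurableT_comp (continuous_measurable_rV cF) (measurable_shift_rV v)).
Qed.

Let mq h k : measurable_fun setT (q h k).
Proof.
apply: measurable_funM => //; apply: measurable_funB; first exact: mshift.
exact: continuous_measurable_rV.
Qed.

(** The steps [h * natSinv k] have size at most [|h|], so all quotients vanish outside the ball of
    radius [M + |h| * |e|]; the mean value theorem bounds them by [K * |h|] inside. *)
Let q_dominated h : exists g : 'rV[R]_n -> R, [/\ lambda.-integrable setT (EFin \o g),
  forall x, 0 <= g x & forall k x, `|q h k x| <= g x].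
Proof.
case: HF => _ _ _ [M F0].
have D0 x : M < `|x| -> 'D_e F x = 0 by move=> xM; exact: derive_eq0 F0 xM.
have [K K0 DK] := bounded_of_support cD D0.
pose M' := M + `|h| * `|e|.
pose g := (fun=> K * `|h|) \_ [set x : 'rV[R]_n | `|x| <= M'].
have g0 x : 0 <= g x by rewrite /g patchE; case: ifP => // _; rewrite mulr_ge0.
exists g; split=> //.
  apply: (@integrable_bounded_support _ (K * `|h|) M').
  - apply/measurable_restrict => //; first exact: measurable_rV_ball.
  - move=> x; rewrite /g patchE; case: ifP => _; rewrite ?normr0 ?mulr_ge0//.
    by rewrite ger0_norm// mulr_ge0.
  - move=> x xM; rewrite /g patchE; case: ifPn => //; rewrite inE/=.
    by rewrite leNgt xM.
move=> k x; rewrite /g patchE; case: ifPn => [_|].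
  rewrite /q normrM; have := increment_le dF DK x (h * natSinv k).
  rewrite -(ler_pM2l (ltr0Sn R k)) ger0_norm// => /le_trans; apply.
  rewrite normrM (ger0_norm (ltW (natSinv_gt0 k))) /natSinv.
  by rewrite mulrCA [_ * (`|h| * _)]mulrCA divff ?mulr1// pnatr_eq0.
rewrite notin_setE/= => /negP; rewrite -ltNge => xM.
have Mx : M < `|x| by apply: le_lt_trans xM; rewrite lerDl mulr_ge0.
rewrite /q (F0 x)// F0 ?subrr ?mulr0 ?normr0//.
have := ler_normB (x + (h * natSinv k) *: e) ((h * natSinv k) *: e).
rewrite addrK normrZ normrM (ger0_norm (ltW (natSinv_gt0 k))) => hx.
have : `|h| * natSinv k * `|e| <= `|h| * `|e|.
  rewrite ler_wpM2r// ler_piMr// /natSinv invf_le1// ler1n//.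
move: xM hx; rewrite /M'; lra.
Qed.

Let q_cvg h x : q h ^~ x @ \oo --> h * 'D_e F x.
Proof. exact: difference_quotient_cvg. Qed.

(** Each difference quotient has integral zero by translation invariance, and dominated convergence
    passes this on to the derivative. *)
Lemma integral_derive0 : \int[lambda]_x 'D_e F x = 0.
Proof.
have [g [ig g0 qg]] := q_dominated 1.
have h : (\int[lambda]_x (q 1 k x)%:E)%E @[k --> \oo] --> (\int[lambda]_x (1 * 'D_e F x)%:E)%E.
  apply: (@dominated_cvg _ _ _ lambda setT measurableT _ _ (EFin \o g)) => //.
  - by move=> k; apply/measurable_EFinP; exact: mq.
  - by move=> x _; apply: cvg_EFin; [exact: nearW|exact: q_cvg].
  - by move=> k x _; rewrite lee_fin; exact: qg.
rewrite /Rintegral; under eq_integral do rewrite -[X in X%:E]mul1r.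
rewrite -(cvg_lim _ h)// (_ : (fun k : nat => _) = cst 0%E) ?lim_cst//.
apply/funext => k /=; rewrite /q.
have iS : lambda.-integrable setT (fun x => (F (x + (1 * natSinv k) *: e))%:E).
  case: HF => _ _ _ [M F0]; have [K K0 FK] := bounded_of_support cF F0.
  apply: (@integrable_bounded_support _ K (M + `|(1 * natSinv k) *: e|)) => // x xM.
  apply: F0; have := ler_normB (x + (1 * natSinv k) *: e) ((1 * natSinv k) *: e).
  by rewrite addrK; lra.
under eq_integral do rewrite EFinM EFinB.
rewrite integralZl//; last by apply: integrableB => //; exact: C1c_integrable.
rewrite integralB//; last exact: C1c_integrable.
have mE : measurable_fun setT (EFin \o F) by apply/measurable_EFinP; exact: continuous_measurable_rV.
rewrite (integral_shift _ mE) subee ?mule0//.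
exact: integrable_fin_num C1c_integrable.
Qed.

(* By translation invariance the left-hand side is subadditive in [h], so it is
   bounded by the L^1 norm of the difference quotients of step [h / k], and these
   converge in L^1 by dominated convergence. *)
Lemma integral_increment_le h :
  (\int[lambda]_x `|F (x + h *: e) - F x|%:E <= `|h|%:E * \int[lambda]_x `|'D_e F x|%:E)%E.
Proof.
have [g [ig g0 qg]] := q_dominated h.
have mN v : measurable_fun setT (fun x => `|F (x + v) - F x|%:E).
  apply/measurable_EFinP; apply: measurableT_comp => //.
  by apply: measurable_funB; [exact: mshift|exact: continuous_measurable_rV].
have H : (\int[lambda]_x `|q h k x|%:E)%E @[k --> \oo] -->
    (\int[lambda]_x `|h * 'D_e F x|%:E)%E.
  apply: (@dominated_cvg _ _ _ lambda setT measurableT _ _ (EFin \o g)) => //.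
  - by move=> k; apply/measurable_EFinP; apply: measurableT_comp => //; exact: mq.
  - move=> x _; apply: cvg_EFin; first exact: nearW.
    by apply: cvg_norm; exact: q_cvg.
  - by move=> k x _; rewrite lee_fin normr_id; exact: qg.
rewrite -ge0_integralZl_EFin//; last first.
  apply/measurable_EFinP; apply: measurableT_comp => //.
  exact: continuous_measurable_rV.
under [leRHS]eq_integral do rewrite -EFinM -normrM.
rewrite -(cvg_lim _ H)//; apply: lime_ge; first by apply/cvg_ex; eexists; exact: H.
apply: nearW => k; pose s := h * natSinv k.
have tele x : F (x + h *: e) - F x =
    \sum_(0 <= j < k.+1) (F (x + (j%:R * s) *: e + s *: e) - F (x + (j%:R * s) *: e)).
  pose G (j : nat) := F (x + (j%:R * s) *: e).
  rewrite (eq_bigr (fun j => G j.+1 - G j)); last first.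
    by move=> j _; rewrite /G -addrA -scalerDl -natr1 mulrDl mul1r.
  rewrite telescope_sumr// /G mul0r scale0r addr0; congr (F (_ + _ *: _) - _).
  by rewrite /s /natSinv mulrCA divff ?mulr1// pnatr_eq0.
apply: (@le_trans _ _ (\int[lambda]_x (\sum_(0 <= j < k.+1)
    `|F (x + (j%:R * s) *: e + s *: e) - F (x + (j%:R * s) *: e)|%:E))%E).
  apply: ge0_le_integral => //.
  - apply: emeasurable_sum => j.
    exact: (measurableT_comp (mN (s *: e)) (measurable_shift_rV _)).
  - by move=> x _; rewrite tele sumEFin lee_fin; exact: ler_norm_sum.
rewrite ge0_integral_sum//; last first.
  by move=> j; apply: (measurableT_comp (mN (s *: e)) (measurable_shift_rV _)).
rewrite (eq_bigr (fun=> \int[lambda]_x `|F (x + s *: e) - F x|%:E)%E); last first.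
  by move=> j _; rewrite (ge0_integral_shift ((j%:R * s) *: e) (mN (s *: e))).
rewrite sumr_const_nat subn0; apply: (@le_trans _ _ (k.+1%:R%:E *
    \int[lambda]_x `|F (x + s *: e) - F x|%:E)%E).
  by rewrite mule_natl.
rewrite -ge0_integralZl_EFin//.
rewrite le_eqVlt; apply/orP; left; apply/eqP; apply: eq_integral => x _.
by rewrite /q normrM ger0_norm// EFinM.
Qed.

End C1c.

End directional.

(** * Integration against a restricted measure *)

Section integral_mrestr.
Context d (T : measurableType d) (R : realType) (mu : {measure set T -> \bar R}).
Context (D : set T) (mD : measurable D).
Local Notation muD := (mrestr mu mD).

(** On subsets of [D], [mu] is the sum of its restrictions to [D] and to the complement, and the
    second one contributes nothing to an integral over [D]. *)
Lemma ge0_integral_mrestr (f : T -> \bar R) : measurable_fun setT f ->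
  (forall x, 0 <= f x)%E -> (\int[muD]_x f x = \int[mu]_(x in D) f x)%E.
Proof.
move=> mf f0; have mDc := measurableC mD.
have mfD : measurable_fun D f by exact: measurable_funTS.
pose m1 : {measure set T -> \bar R} := muD.
pose m2 : {measure set T -> \bar R} := mrestr mu mDc.
transitivity (\int[m1]_(x in D) f x)%E.
  rewrite (@ge0_negligible_integral _ _ _ m1 setT (~` D))//; last first.
    by rewrite /m1/= /mrestr setICl measure0.
  by rewrite setTD setCK.
transitivity (\int[m1]_(x in D) f x + \int[m2]_(x in D) f x)%E.
  rewrite (@ge0_negligible_integral _ _ _ m2 D D)//; last first.
    by rewrite /m2/= /mrestr setICr measure0.
  by rewrite setDv integral_set0 adde0.
have <- := ge0_integral_measure_add m1 m2 mD (fun x _ => f0 x) mfD.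
apply: eq_measure_integral => A mA AD; rewrite [LHS]measure_addE /m1 /m2/= /mrestr.
by rewrite [A `&` D]setIidl// [A `&` ~` D](_ : _ = set0) ?measure0 ?adde0//;
  apply/disjoints_subset; rewrite setCK.
Qed.

Lemma integral_mrestr (f : T -> \bar R) : measurable_fun setT f ->
  (forall x, ~ D x -> f x = 0%E) -> (\int[muD]_x f x = \int[mu]_x f x)%E.
Proof.
move=> mf f0.
have E : f = f \_ D.
  apply/funext => x; rewrite patchE; case: ifPn => //.
  by rewrite notin_setE; exact: f0.
have h g : measurable_fun setT g -> (forall x, ~ D x -> g x = 0%E) ->
    (forall x, 0 <= g x)%E -> (\int[muD]_x g x = \int[mu]_x g x)%E.
  move=> mg gD g0; rewrite ge0_integral_mrestr// integral_mkcond.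
  apply: eq_integral => x _; rewrite patchE; case: ifPn => //.
  by rewrite notin_setE => /gD ->.
rewrite [LHS]integralE [RHS]integralE; congr (_ - _)%E; apply: h.
- exact: measurable_funepos.
- by move=> x /f0 fx; rewrite funeposE fx maxxx.
- by move=> x; exact: funepos_ge0.
- exact: measurable_funeneg.
- by move=> x /f0 fx; rewrite funenegE fx oppe0 maxxx.
- by move=> x; exact: funeneg_ge0.
Qed.

End integral_mrestr.

(** * Test functions *)

Section smooth_functions.
Context {R : realType} {d : nat}.
Implicit Types (f g : 'rV[R]_d -> R) (i : 'I_d) (s : seq 'I_d).

Lemma smooth_continuous f : smooth f -> continuous f.
Proof. by move=> /(_ [::])[]. Qed.

Lemma smooth_derivable f i x : smooth f -> derivable f x (delta_mx ord0 i).
Proof. by move=> /(_ [::])[_ /(_ i x)]. Qed.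

(** [foldr] applies the last letter of a word first: the derivatives of [partial i f] are those of
    [f] along words ending in [i]. *)
Lemma smooth_partial i f : smooth f -> smooth (partial i f).
Proof. by move=> sf s; have := sf (rcons s i); rewrite foldr_rcons. Qed.

Lemma foldr_partial_lin (k : R) f g : smooth f -> smooth g -> forall s,
  foldr partial (k *: f + g) s = k *: foldr partial f s + foldr partial g s.
Proof.
move=> sf sg; elim=> [//|i s IH] /=; rewrite IH; apply/funext => x.
rewrite /partial deriveD ?deriveZ//.
- by have [_] := sf s; exact.
- by apply: derivableZ; have [_] := sf s; exact.
- by have [_] := sg s; exact.
Qed.

Lemma smooth_lin (k : R) f g : smooth f -> smooth g -> smooth (k *: f + g).
Proof.
move=> sf sg s; rewrite foldr_partial_lin//.
have [cf df] := sf s; have [cg dg] := sg s; split=> [x|i x].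
  apply: continuousD; last exact: cg.
  by apply: (@continuousM _ _ (cst k)); [exact: cst_continuous|exact: cf].
by apply: derivableD; [apply: derivableZ; exact: df|exact: dg].
Qed.

Lemma partial_lin i (k : R) f g : smooth f -> smooth g ->
  partial i (k *: f + g) = k *: partial i f + partial i g.
Proof. by move=> sf sg; exact: (foldr_partial_lin k sf sg [:: i]). Qed.

End smooth_functions.

Section test_functions.
Context {R : realType} {d : nat} {Omega : set 'rV[R]_d}.
Implicit Types (f g phi psi : 'rV[R]_d -> R) (i : 'I_d).
Local Notation test := (test_function Omega).
Local Notation supp f := [set x | f x != 0].

Lemma test_function_sub f g : smooth g -> test f ->
  closure (supp g) `<=` closure (supp f) -> test g.
Proof.
move=> sg [sf cf fO] gf; split=> //; last exact: subset_trans fO.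
by apply: subclosed_compact cf gf; exact: closed_closure.
Qed.

Lemma test_function0 : test 0.
Proof.
have E : closure (supp (0 : 'rV[R]_d -> R)) = set0.
  rewrite (_ : [set _ | _] = set0) ?closure0//.
  by apply/seteqP; split=> x //=; rewrite eqxx.
split; rewrite ?E; [|exact: compact0|exact: sub0set].
move=> s; have -> : foldr partial (0 : 'rV[R]_d -> R) s = cst 0.
  elim: s => [//|i s /= ->]; apply/funext => x; exact: derive_cst.
by split=> [x|i x]; [exact: cst_continuous|exact: derivable_cst].
Qed.

Lemma test_function_lin (k : R) f g : test f -> test g -> test (k *: f + g).
Proof.
move=> [sf cf fO] [sg cg gO].
have sub : closure (supp (k *: f + g)) `<=` closure (supp f) `|` closure (supp g).
  rewrite -closureU; apply: closure_subset => x /=; apply: contraNP => /not_orP[].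
  move=> /negP/negPn/eqP fx /negP/negPn/eqP gx; apply/eqP.
  by rewrite -[LHS]/(k * f x + g x) fx gx mulr0 addr0.
split; [exact: smooth_lin| |by move=> x /sub[/fO|/gO]].
by apply: subclosed_compact (compactU cf cg) sub; exact: closed_closure.
Qed.

Lemma test_function_subspace : subspace test.
Proof. by split; [exact: test_function0|exact: test_function_lin]. Qed.

(** Off the closed support [f] vanishes on a whole neighbourhood, hence so does its derivative at
    that point. *)
Lemma test_function_partial i f : test f -> test (partial i f).
Proof.
move=> tf; have [sf _ _] := tf.
apply: (test_function_sub (smooth_partial i sf) tf).
rewrite [X in _ `<=` X]((closure_id _).1 (@closed_closure _ _)).
apply: closure_subset => x /=; apply: contraNP => xf.
rewrite /partial -(derive_cst (0 : R) x (delta_mx ord0 i)); apply/eqP/near_eq_derive.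
have : nbhs x (~` closure (supp f)).
  by apply: open_nbhs_nbhs; split=> //; exact/closed_openC/closed_closure.
apply: filterS => y /= fy; apply/eqP; apply: contraPT fy => fy.
by apply; exact: subset_closure.
Qed.

Lemma test_function_eq0 f x : test f -> ~ Omega x -> f x = 0.
Proof.
move=> [_ _ fO] nOx; apply/eqP; apply: contraPT nOx => fx.
by apply; apply: fO; exact: subset_closure.
Qed.

Lemma test_function_support f : test f -> exists M, forall x, M < `|x| -> f x = 0.
Proof.
move=> [_ /compact_bounded[M [_ HM]] _]; exists (M + 1) => x Mx.
apply/eqP; apply: contraTT Mx => fx; rewrite -leNgt; apply: (HM (M + 1)); first by rewrite ltrDl.
exact: subset_closure.
Qed.

Lemma test_function_continuous f : test f -> continuous f.
Proof. by move=> [sf _ _]; exact: smooth_continuous. Qed.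

Lemma test_function_bounded f : test f -> exists2 K, 0 <= K & forall x, `|f x| <= K.
Proof.
move=> tf; have [M fM] := test_function_support tf.
exact: bounded_of_support (test_function_continuous tf) fM.
Qed.

Lemma test_function_C1c i f : test f -> C1c (delta_mx ord0 i) f.
Proof.
move=> tf; have [sf _ _] := tf; split; last exact: test_function_support.
- exact: smooth_continuous.
- by move=> x; exact: smooth_derivable.
- exact: smooth_continuous (smooth_partial i sf).
Qed.

Lemma partialM i f g x : test f -> test g ->
  'D_(delta_mx ord0 i) (f * g) x = f x * partial i g x + g x * partial i f x.
Proof. by move=> [sf _ _] [sg _ _]; rewrite deriveM//; exact: smooth_derivable. Qed.

Lemma test_functionM_C1c i f g : test f -> test g -> C1c (delta_mx ord0 i) (f * g).
Proof.
move=> tf tg; have [sf _ _] := tf; have [sg _ _] := tg.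
have cf := test_function_continuous tf; have cg := test_function_continuous tg.
split.
- by move=> x; apply: continuousM; [exact: cf|exact: cg].
- by move=> x; apply: derivableM; exact: smooth_derivable.
- rewrite (_ : 'D_ _ _ = f * partial i g + g * partial i f); last first.
    by apply/funext => x; rewrite partialM.
  by move=> x; apply: continuousD; apply: continuousM; [exact: cf| |exact: cg|];
    apply: smooth_continuous; exact: smooth_partial.
- have [M fM] := test_function_support tf; exists M => x /fM fx.
  by rewrite /= -[LHS]/(f x * g x) fx mul0r.
Qed.

End test_functions.

(** * Integration by parts and the Poincare inequality on a bounded open set *)

Section bounded_domain.
Context {R : realType} {d : nat} {Omega : set 'rV[R]_d}.
Context (oOmega : open Omega) (bOmega : bounded_set Omega).
Implicit Types (f g phi psi : 'rV[R]_d -> R) (i : 'I_d) (x : 'rV[R]_d).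
Local Notation test := (test_function Omega).
Local Notation mu := (lebesgue_on oOmega).
Local Notation lambda := (lebesgue_rV d).
Local Notation L2 := (L2 oOmega).
Local Notation inner := (inner oOmega).

Lemma bounded_domainP : exists2 M : R, 0 < M & forall x, Omega x -> `|x| <= M.
Proof.
have [M [_ HM]] := bOmega; exists (`|M| + 1); first by rewrite ltr_wpDl.
by apply: HM; rewrite (le_lt_trans (ler_norm _))// ltrDl.
Qed.

Lemma lebesgue_on_lty : (mu setT < +oo)%E.
Proof.
have [M _ OM] := bounded_domainP; apply: le_lt_trans (@lebesgue_rV_ball_lty R d M).
rewrite /= /mrestr setTI; apply: le_measure => //; rewrite inE.
  exact: open_measurable_rV.
exact: measurable_rV_ball.
Qed.

Lemma L2_subspace : subspace L2.
Proof. exact: sqint_subspace. Qed.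

Lemma semi_inner_inner : semi_inner L2 inner.
Proof. exact: semi_inner_ip. Qed.

Lemma test_function_measurable phi : test phi -> measurable_fun setT phi.
Proof. by move=> tf; apply: continuous_measurable_rV; exact: test_function_continuous tf. Qed.

Lemma test_function_L2 phi : test phi -> L2 phi.
Proof.
move=> tf; have [K K0 fK] := test_function_bounded tf.
apply: (@sqint_bounded _ _ _ _ lebesgue_on_lty _ K); first exact: test_function_measurable.
exact: aeW.
Qed.

Lemma Rintegral_lebesgue_on f : measurable_fun setT f ->
  (forall x, ~ Omega x -> f x = 0) -> \int[mu]_x f x = \int[lambda]_x f x.
Proof.
move=> mf f0; congr fine; apply: integral_mrestr; first exact/measurable_EFinP.
by move=> x /f0 ->.
Qed.

(** The derivative of the product [phi * psi] has integral zero. In the limit this makes the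
    constructed field a weak gradient. *)
Lemma inner_partial i phi psi : test phi -> test psi ->
  inner phi (partial i psi) = - inner (partial i phi) psi.
Proof.
move=> tf tg; have tf' := test_function_partial i tf; have tg' := test_function_partial i tg.
have Lf := test_function_L2 tf; have Lg := test_function_L2 tg.
have Lf' := test_function_L2 tf'; have Lg' := test_function_L2 tg'.
apply/eqP; rewrite -subr_eq0 opprK; apply/eqP.
rewrite (semi_innerC semi_inner_inner Lf')//.
rewrite -[RHS](integral_derive0 (test_functionM_C1c i tf tg)).
rewrite -Rintegral_lebesgue_on.
- rewrite -RintegralD//; [|exact: sqintM|exact: sqintM].
  by apply: eq_Rintegral => x _; rewrite (partialM i x tf tg).
- apply: continuous_measurable_rV.
  by have [] := test_functionM_C1c i tf tg.
- move=> x nOx; rewrite (partialM i x tf tg) (test_function_eq0 tf nOx).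
  by rewrite (test_function_eq0 tg nOx) !mul0r addr0.
Qed.

Lemma integral_norm_test_function phi : test phi ->
  ((\int[mu]_x `|phi x|)%:E = \int[lambda]_x `|phi x|%:E)%E.
Proof.
move=> tf; rewrite fineK; last first.
  have := integrable_norm (sqint_integrable lebesgue_on_lty (test_function_L2 tf)).
  exact: integrable_fin_num.
apply: integral_mrestr.
  by apply/measurable_EFinP; apply: measurableT_comp => //; exact: test_function_measurable.
by move=> x /(test_function_eq0 tf) ->; rewrite normr0.
Qed.

(** By translation invariance the L^1 norm of the increment is subadditive in the translation, which
    can therefore be made along one axis after another. *)
Lemma test_function_increment_le phi (z : 'rV[R]_d) : test phi ->
  (\int[lambda]_x `|phi (x + z) - phi x|%:E <=
   (\sum_i `|z ord0 i| * \int[mu]_x `|partial i phi x|)%:E)%E.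
Proof.
move=> tf; have mf := test_function_measurable tf.
pose N w := (\int[lambda]_x `|phi (x + w) - phi x|%:E)%E.
have mN (w : 'rV[R]_d) : measurable_fun setT (fun x => `|phi (x + w) - phi x|%:E).
  apply/measurable_EFinP; apply: measurableT_comp => //.
  by apply: measurable_funB => //; exact: (measurableT_comp mf (measurable_shift_rV w)).
have ND v w : (N (v + w)%R <= N v + N w)%E.
  have mNv : measurable_fun setT (fun x => `|phi (x + v + w) - phi (x + v)|%:E).
    exact: (measurableT_comp (mN w) (measurable_shift_rV v)).
  rewrite addeC /N -(ge0_integral_shift v (mN w))// -ge0_integralD//.
  apply: ge0_le_integral => //; first exact: emeasurable_funD.
  move=> x _; rewrite -EFinD lee_fin addrA.
  by rewrite -[X in `|X|](subrKA (phi (x + v))) ler_normD.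
rewrite [in leLHS](_ : z = \sum_i z ord0 i *: delta_mx ord0 i); last first.
  by rewrite {1}(row_sum_delta z).
rewrite -sumEFin; elim/big_ind2 : _ => [|v a w b va wb|i _].
- rewrite (eq_integral (cst 0%E)) ?integral0// => x _.
  by rewrite addr0 subrr normr0.
- exact: le_trans (ND _ _) (leeD va wb).
- apply: le_trans (integral_increment_le (test_function_C1c i tf) _) _.
  by rewrite EFinM integral_norm_test_function//; exact: test_function_partial.
Qed.

(* Apply [integral_increment_le] to [phi ^ 2], with a translation by more than the
   diameter of [Omega], which makes the two terms of the increment disjoint. *)
Lemma poincare (i0 : 'I_d) : exists2 C : R, 0 < C & forall phi, test phi ->
  inner phi phi <= C * \sum_(i < d) inner (partial i phi) (partial i phi).
Proof.
have [M M0 OM] := bounded_domainP.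
pose h := 2 * M + 1; have h0 : 0 < h by rewrite /h; lra.
exists (4 * h ^+ 2) => [|phi tf]; first by rewrite mulr_gt0// exprn_gt0.
have tf' := test_function_partial i0 tf.
have Lf := test_function_L2 tf; have Lf' := test_function_L2 tf'.
pose e : 'rV[R]_d := delta_mx ord0 i0; pose F := phi * phi.
have HF : C1c e F := test_functionM_C1c i0 tf tf.
have DF x : 'D_e F x = 2 * (phi x * partial i0 phi x).
  by rewrite (partialM i0 x tf tf); ring.
have mF : measurable_fun setT F by apply: measurable_funM; exact: test_function_measurable.
have h1 : (\int[lambda]_x (F x)%:E <= \int[lambda]_x `|F (x + h *: e) - F x|%:E)%E.
  apply: ge0_le_integral => //.
  - by move=> x _; rewrite lee_fin /F -[_ x]/(phi x * phi x) -expr2 sqr_ge0.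
  - exact/measurable_EFinP.
  - apply/measurable_EFinP; apply: measurableT_comp => //; apply: measurable_funB => //.
    exact: (measurableT_comp mF (measurable_shift_rV _)).
  move=> x _; rewrite lee_fin.
  have [Ox|nOx] := pselect (Omega x); last first.
    by rewrite {1}/F -[_ x]/(phi x * phi x) (test_function_eq0 tf nOx) mul0r.
  have nO : ~ Omega (x + h *: e).
    move=> /OM /(mx_norm_leP _ (ltW M0))/(_ i0); rewrite !mxE !eqxx mulr1.
    have /(mx_norm_leP _ (ltW M0))/(_ i0) := OM _ Ox.
    by rewrite !ler_norml => /andP[h1 _] /andP[_]; rewrite /h; lra.
  rewrite [F (x + _)](_ : _ = 0); last first.
    by rewrite -[LHS]/(phi _ * phi _) (test_function_eq0 tf nO) mul0r.
  by rewrite sub0r normrN ler_norm.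
have key : inner phi phi <= h * \int[mu]_x `|2 * (phi x * partial i0 phi x)|.
  rewrite -lee_fin [leLHS]ipE//.
  rewrite (@integral_mrestr _ _ _ lambda _ (open_measurable_rV oOmega) (EFin \o F)); last 2 first.
  - exact/measurable_EFinP.
  - by move=> x nOx /=; rewrite -[F x]/(phi x * phi x) (test_function_eq0 tf nOx) mul0r.
  apply: le_trans h1 _; apply: le_trans (integral_increment_le HF h) _.
  rewrite (ger0_norm (ltW h0)) EFinM lee_pmul2l ?lte_fin//.
  rewrite fineK; last first.
    apply: integrable_fin_num => //.
    apply: (@integrable_norm _ _ _ mu setT (fun x => 2 * (phi x * partial i0 phi x))).
    by apply: eq_integrable (integrableZl measurableT 2 (sqintM Lf Lf')).
  rewrite [leLHS](eq_integral (fun x => `|2 * (phi x * partial i0 phi x)|%:E)); last first.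
    by move=> x _; congr (`|_|%:E); exact: DF.
  rewrite [leRHS](@integral_mrestr _ _ _ lambda _ (open_measurable_rV oOmega)
    (fun x => `|2 * (phi x * partial i0 phi x)|%:E))//.
    apply/measurable_EFinP; apply: measurableT_comp => //; apply: measurable_funM => //.
    by apply: measurable_funM; exact: test_function_measurable.
  by move=> x nOx; rewrite (test_function_eq0 tf nOx) mul0r mulr0 normr0.
(* The weight [2^-1] allows the first term to be absorbed into the left-hand side of [key], which
   leaves the constant [4 * h ^+ 2]. *)
have amgm : h * \int[mu]_x `|2 * (phi x * partial i0 phi x)| <=
    2^-1 * inner phi phi + 2 * h ^+ 2 * inner (partial i0 phi) (partial i0 phi).
  have I1 := sqintM Lf Lf; have I2 := sqintM Lf' Lf'.
  have I3 := integrable_norm (integrableZl measurableT 2 (sqintM Lf Lf')).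
  rewrite -!RintegralZl// -RintegralD//; last 2 first.
  - by apply: eq_integrable (integrableZl measurableT 2^-1 I1).
  - by apply: eq_integrable (integrableZl measurableT (2 * h ^+ 2) I2).
  apply: le_Rintegral => //.
  - by apply: eq_integrable (integrableZl measurableT h I3).
  - by apply: eq_integrable (integrableD _ (integrableZl measurableT 2^-1 I1)
      (integrableZl measurableT (2 * h ^+ 2) I2)).
  move=> x _; rewrite -[X in X * `|_|](ger0_norm (ltW h0)) -normrM ler_norml.
  have p := sqr_ge0 (phi x + 2 * h * partial i0 phi x).
  have q := sqr_ge0 (phi x - 2 * h * partial i0 phi x).
  by apply/andP; split; nra.
have : inner phi phi <= 4 * h ^+ 2 * inner (partial i0 phi) (partial i0 phi).
  by move: key amgm; lra.
move=> /le_trans; apply; rewrite ler_pM2l ?mulr_gt0 ?exprn_gt0//.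
rewrite (bigD1 i0)//= lerDl sumr_ge0// => i _.
exact/(semi_inner_ge0 semi_inner_inner)/test_function_L2/test_function_partial.
Qed.

End bounded_domain.

(** * The Green operator *)

Section green_operator.
Context {R : realType} {d : nat} {Omega : set 'rV[R]_d}.
Context (oOmega : open Omega) (bOmega : bounded_set Omega).
Implicit Types (f u v phi psi : 'rV[R]_d -> R) (g h : 'I_d -> 'rV[R]_d -> R).
Implicit Types (i : 'I_d) (x : 'rV[R]_d).
Local Notation test := (test_function Omega).
Local Notation L2 := (L2 oOmega).
Local Notation inner := (inner oOmega).

Definition grad phi : 'I_d -> 'rV[R]_d -> R := fun i => partial i phi.

Definition dot g h : R := \sum_(i < d) inner (g i) (h i).

Definition L2d := [set g | forall i, L2 (g i)].

Let sL : subspace L2 := L2_subspace oOmega.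
Let hL : semi_inner L2 inner := semi_inner_inner oOmega.

Lemma semi_inner_dot : semi_inner L2d dot.
Proof.
split.
- by move=> g h Lg Lh; apply: eq_bigr => i _; exact: semi_innerC hL _ _ (Lg i) (Lh i).
- move=> k g h z Lg Lh Lz; rewrite /dot mulr_sumr -big_split/=.
  by apply: eq_bigr => i _; case: hL => _ H _; exact: H.
- by move=> g Lg; apply: sumr_ge0 => i _; exact: semi_inner_ge0 hL _ (Lg i).
Qed.

Lemma grad_lin (k : R) phi psi : test phi -> test psi ->
  grad (k *: phi + psi) = k *: grad phi + grad psi.
Proof. by move=> [sf _ _] [sg _ _]; apply/funext => i; exact: partial_lin. Qed.

Lemma grad_L2 phi : test phi -> L2d (grad phi).
Proof. by move=> tf i; exact/test_function_L2/test_function_partial. Qed.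

Local Notation energy phi psi := (dot (grad phi) (grad psi)).

Lemma semi_inner_energy : semi_inner test (fun phi psi => energy phi psi).
Proof.
have [dC dD d0] := semi_inner_dot; split.
- by move=> f g tf tg; apply: dC; exact: grad_L2.
- by move=> k f g h tf tg th; rewrite grad_lin// dD//; exact: grad_L2.
- by move=> f tf; apply: d0; exact: grad_L2.
Qed.

Let st : subspace test := test_function_subspace.
Let L2t phi : test phi -> L2 phi. Proof. exact: test_function_L2. Qed.

(** One sequence serves [v] and all components of [h]: each squared distance is a term of
    [W12_sqnorm], whose other terms are nonnegative. *)
Lemma W12_0_approx v h : W12_0 oOmega v h -> exists phi : nat -> 'rV[R]_d -> R,
  [/\ forall k, test (phi k),
      limit (fun z => inner z z) phi v &
      forall i, limit (fun z => inner z z) (fun k => partial i (phi k)) (h i)].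
Proof.
move=> [Lv wh app].
have ex k : exists phi, test phi /\
    W12_sqnorm oOmega (v - phi) (fun i => h i - partial i phi) < natSinv k.
  by have [phi t p] := app _ (natSinv_gt0 k); exists phi.
have [phi phiP] := choice ex.
have tp k : test (phi k) by exact: (phiP k).1.
have Lh i : L2 (h i) := (wh i).1.
have L1 k : L2 (v - phi k) by apply: (subspaceB sL) => //; exact: L2t.
have L2' i k : L2 (h i - partial i (phi k)).
  by apply: (subspaceB sL) => //; exact: grad_L2.
have s0 k : 0 <= \sum_(i < d) inner (h i - partial i (phi k)) (h i - partial i (phi k)).
  by apply: sumr_ge0 => i _; exact: semi_inner_ge0 hL _ (L2' i k).
exists phi; split=> // [e e0|i e e0]; have [N Ne] := ex_natSinv_le e0; exists N => k Nk;
    have Nk' := @le_natSinv R _ _ Nk; have := (phiP k).2; rewrite /W12_sqnorm.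
  by rewrite (semi_inner_sqBC sL hL)//; [have := s0 k; lra|exact: L2t].
rewrite (semi_inner_sqBC sL hL)//; last exact: grad_L2.
have := semi_inner_ge0 hL (L1 k).
have : inner (h i - partial i (phi k)) (h i - partial i (phi k)) <=
    \sum_(i < d) inner (h i - partial i (phi k)) (h i - partial i (phi k)).
  rewrite (bigD1 i)//= lerDl; apply: sumr_ge0 => j _.
  exact: semi_inner_ge0 hL _ (L2' j k).
lra.
Qed.

Lemma energy_cvg (phi : nat -> 'rV[R]_d -> R) g h : (forall k, test (phi k)) ->
  L2d g -> L2d h ->
  (forall i, limit (fun z => inner z z) (fun k => partial i (phi k)) (g i)) ->
  (fun k => dot (grad (phi k)) h) @ \oo --> dot g h.
Proof.
move=> tp Lg Lh pg; apply: cvgn_sum => i.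
exact: (limit_inner sL hL (fun k => grad_L2 (tp k) i) (Lg i) (pg i) (Lh i)).
Qed.

Context (i0 : 'I_d).

(** Dirichlet's principle over test functions. A minimizing sequence of [Q] is Cauchy in energy,
    hence in L^2 by the Poincare inequality; the limits of the functions and of their partial
    derivatives are the solution and its weak gradient. *)
Lemma dirichlet_solution_exists f : L2 f -> exists u, dirichlet_solution oOmega f u.
Proof.
move=> Lf; have [C C0 poinc] := poincare oOmega bOmega i0.
have he := semi_inner_energy.
pose Q phi := energy phi phi - 2 * inner f phi.
(* Expand the square of [phi - C *: f], bound the square of [phi] by [C] times its energy, and
   divide by [C]. *)
have QC phi : test phi -> - (C * inner f f) <= Q phi.
  move=> tp; have := semi_inner_ge0 hL (sL.2 (- C) _ _ Lf (L2t tp)).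
  rewrite (semi_inner_lin sL hL)//; last exact: L2t.
  have := poinc _ tp; rewrite -/(energy phi phi) /Q => h1 h2.
  by rewrite -(ler_pM2l C0); lra.
have [phi [tp cp mp]] : exists phi : nat -> 'rV[R]_d -> R, [/\ forall k : nat, test (phi k),
    cauchy (fun z => energy z z) phi &
    forall k psi, test psi -> Q (phi k) <= Q psi + natSinv k].
  (* The nested family is constant; the function 0, where [Q] vanishes, provides the upper bound. *)
  apply: (@nested_minimizers _ _ Q (fun z => energy z z) (fun=> test)
    (- (C * inner f f)) 0) => //.
  - by move=> j k _ x.
  - move=> _; have t0 : test 0 := st.1; exists 0 => //.
    have e0 := semi_inner0l st he t0; rewrite /Q [X in X - _]e0.
    by rewrite (semi_innerC hL Lf (L2t t0)) (semi_inner0l sL hL Lf) mulr0 subr0.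
  - by move=> _ x y tx ty; apply: (subspaceZ st); exact: (subspaceD st).
  - move=> x y tx ty; rewrite /Q (semi_inner_sq_half st he)//.
    have txy : test (x + y) by exact: (subspaceD st).
    rewrite (semi_innerZr sL hL) ?(semi_innerDr sL hL)//; try exact: L2t.
    move: (inner f x) (inner f y) => p q /=.
    move: (energy x x) (energy y y) (energy (x - y) (x - y)) => r s t; ring.
have tB j k : test (phi j - phi k) by exact: (subspaceB st).
have gB j k : grad (phi j - phi k) = grad (phi j) - grad (phi k).
  by rewrite addrC -scaleN1r grad_lin// scaleN1r addrC.
have cu : cauchy (fun z => inner z z) phi.
  move=> e e0; have eC : 0 < e / C by rewrite divr_gt0.
  have [N NP] := cp _ eC; exists N => j k Nj Nk.
  apply: le_trans (poinc _ (tB j k)) _; rewrite -ler_pdivlMl// mulrC.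
  exact: NP.
have cg i : cauchy (fun z => inner z z) (fun k => partial i (phi k)).
  move=> e e0; have [N NP] := cp _ e0; exists N => j k Nj Nk.
  apply: le_trans (NP _ _ Nj Nk); rewrite gB /dot (bigD1 i)//= lerDl.
  apply: sumr_ge0 => m _; apply: (semi_inner_ge0 hL).
  by apply: (subspaceB sL); exact: grad_L2.
have muoo := lebesgue_on_lty oOmega bOmega.
have [u Lu pu] := sqint_complete muoo (fun k => L2t (tp k)) cu.
have exg i : exists gi, L2 gi /\ limit (fun z => inner z z) (fun k => partial i (phi k)) gi.
  have [gi Lgi pgi] := sqint_complete muoo (fun k => grad_L2 (tp k) i) (cg i).
  by exists gi.
have [g gP] := choice exg.
have Lg i : L2 (g i) := (gP i).1.
have Lpk k : L2 (phi k) := L2t (tp k).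
have Lgk i k : L2 (partial i (phi k)) := grad_L2 (tp k) i.
have wg : weak_gradient oOmega u g.
  move=> i; split=> // psi tpsi.
  have l1 := limit_inner sL hL Lpk Lu pu (grad_L2 tpsi i).
  have l2 := limit_inner sL hL (Lgk i) (Lg i) (gP i).2 (L2t tpsi).
  have E : (fun k => inner (phi k) (partial i psi)) =
           (fun k => - inner (partial i (phi k)) psi).
    by apply/funext => k; exact: inner_partial.
  have : (fun k => - inner (partial i (phi k)) psi) @ \oo --> - inner (g i) psi.
    exact: cvgN.
  by rewrite -E => l3; exact: (cvg_unique (@norm_hausdorff _ R) l1 l3).
have W : W12_0 oOmega u g.
  split=> // e e0.
  have c0 : (fun k => W12_sqnorm oOmega (phi k - u) (fun i => partial i (phi k) - g i))
      @ \oo --> (0 : R).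
    rewrite -[X in _ --> X]addr0; apply: cvgD; first exact: (limit_sqB sL hL).
    have := @cvgn_sum _ _ (index_enum 'I_d) _ _
      (fun i => limit_sqB sL hL (Lgk i) (Lg i) (gP i).2).
    by rewrite big1_eq.
  have /cvgr0Pnorm_lt/(_ _ e0)[N _ /(_ N (leqnn N))/=] := c0.
  rewrite -/(W12_sqnorm _ _ _) => WN; exists (phi N) => //.
  apply: le_lt_trans WN; apply: le_trans (ler_norm _).
  rewrite /W12_sqnorm (semi_inner_sqBC sL hL)//; apply: lerD => //; apply: ler_sum => i _.
  by rewrite (semi_inner_sqBC sL hL).
exists u, g => // v h Wv.
have weak psi : test psi -> dot g (grad psi) = inner f psi.
  move=> tpsi; have Lgp := grad_L2 tpsi.
  pose l := dot g (grad psi) - inner f psi; pose A := energy psi psi.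
  have A0 : 0 <= A := semi_inner_ge0 he tpsi.
  (* Compare [phi k] with [phi k + s *: psi]: the first is minimal up to [natSinv k], an error that
     disappears in the limit. *)
  have H s : 0 <= 2 * s * l + s ^+ 2 * A.
    have lk : (fun k => 2 * s * (energy (phi k) psi - inner f psi) + s ^+ 2 * A + natSinv k)
        @ \oo --> 2 * s * l + s ^+ 2 * A + 0.
      apply: cvgD; last exact: cvg_harmonic.
      apply: cvgD; last exact: cvg_cst.
      apply: cvgM; first exact: cvg_cst.
      apply: cvgB; last exact: cvg_cst.
      by apply: energy_cvg => // i; exact: (gP i).2.
    rewrite -[leRHS]addr0 -(cvg_lim _ lk)//; apply: limr_ge.
      by apply/cvg_ex; eexists; exact: lk.
    apply: nearW => k; have tks := st.2 s _ _ tpsi (tp k).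
    have := mp k _ tks; rewrite /Q (semi_inner_lin st he)//.
    have [_ hl _] := hL.
    rewrite [inner f (_ + _)](semi_innerC hL)//; last exact: L2t.
    rewrite hl//; [|exact: L2t].
    rewrite (semi_innerC hL (L2t tpsi) Lf) (semi_innerC hL (Lpk k) Lf).
    have -> : energy psi (phi k) = energy (phi k) psi := semi_innerC he tpsi (tp k).
    rewrite /A; move: (inner f psi) (inner f (phi k)) => p q /=.
    move: (energy psi psi) (energy (phi k) psi) (energy (phi k) (phi k)) => r1 r2 r3.
    lra.
  apply/eqP; rewrite -subr_eq0 -/l; apply/eqP; apply: contrapT => /eqP l0.
  (* If [l] were nonzero, this [s] would make the expression negative; [A + 1] serves as denominator
     because [A] may vanish. *)
  have := H (- l / (A + 1)).
  have A1 : 0 < A + 1 by lra.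
  have -> : 2 * (- l / (A + 1)) * l + (- l / (A + 1)) ^+ 2 * A =
     - (l ^+ 2 * (A + 2) / (A + 1) ^+ 2) by field; rewrite gt_eqF.
  rewrite oppr_ge0 leNgt => /negP; apply.
  by rewrite divr_gt0 ?exprn_gt0// mulr_gt0 ?exprn_even_gt0//; lra.
(* The weak equation is now carried from test functions to all of W_0^{1,2} by density. *)
have [psi [tpsi pv ph]] := W12_0_approx Wv.
have [Lv wh _] := Wv; have Lh i : L2 (h i) := (wh i).1.
have l1 : (fun k => dot (grad (psi k)) g) @ \oo --> dot h g by exact: energy_cvg.
have l2 := limit_inner sL hL (fun k => L2t (tpsi k)) Lv pv Lf.
rewrite -/(dot g h) (semi_innerC semi_inner_dot)// (semi_innerC hL)//.
apply: (cvg_unique (@norm_hausdorff _ R) l1).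
rewrite (_ : (fun k => _) = fun k => inner (psi k) f)//; apply/funext => k.
rewrite (semi_innerC semi_inner_dot)//; last exact: grad_L2.
by rewrite weak// (semi_innerC hL)//; exact: L2t.
Qed.

Lemma greenP f : L2 f -> exists2 g, W12_0 oOmega (green oOmega f) g &
  forall v h, W12_0 oOmega v h -> dot g h = inner f v.
Proof. by move=> /dirichlet_solution_exists; exact: getPex. Qed.

Lemma green_L2 f : L2 f -> L2 (green oOmega f).
Proof. by move=> /greenP[g []]. Qed.

Definition green_form f f' := inner f (green oOmega f').

Lemma green_formP f : L2 f -> exists2 g, W12_0 oOmega (green oOmega f) g &
  (forall f', L2 f' -> forall g', W12_0 oOmega (green oOmega f') g' ->
    dot g g' = green_form f f').
Proof.
by move=> Lf; have [g Wg gP] := greenP Lf; exists g => // f' _ g' Wg'; exact: gP.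
Qed.

Lemma W12_0_L2d v h : W12_0 oOmega v h -> L2d h.
Proof. by move=> [_ wh _] i; exact: (wh i).1. Qed.

(** By [green_formP] the form is a [dot] of gradients, whence symmetry and positivity; linearity in
    the first argument is that of [inner]. *)
Lemma semi_inner_green : semi_inner L2 green_form.
Proof.
split.
- move=> f f' Lf Lf'.
  have [g Wg gP] := green_formP Lf; have [g' Wg' gP'] := green_formP Lf'.
  rewrite -(gP _ Lf' _ Wg') -(gP' _ Lf _ Wg).
  exact: semi_innerC semi_inner_dot _ _ (W12_0_L2d Wg) (W12_0_L2d Wg').
- by move=> k f f' f'' Lf Lf' Lf''; have [_ H _] := hL; apply: H => //; exact: green_L2.
- move=> f Lf; have [g Wg gP] := green_formP Lf; rewrite -(gP _ Lf _ Wg).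
  exact: semi_inner_ge0 semi_inner_dot _ (W12_0_L2d Wg).
Qed.

(* The test functions are dense, so this is [J f = sup_phi (f, phi)^2 / energy]. *)
Lemma J_le f (M : R) : L2 f -> 0 <= M ->
  (forall phi, test phi -> inner f phi ^+ 2 <= M * energy phi phi) ->
  J oOmega f <= M.
Proof.
move=> Lf M0 H; have [g Wg gP] := green_formP Lf.
have [phi [tp pu pg]] := W12_0_approx Wg.
have Lg := W12_0_L2d Wg; have Lu := green_L2 Lf.
have l1 := limit_inner sL hL (fun k => L2t (tp k)) Lu pu Lf.
have l2 : (fun k => energy (phi k) (phi k)) @ \oo --> dot g g.
  by apply: cvgn_sum => i; exact: (limit_sq sL hL (fun k => grad_L2 (tp k) i) (Lg i) (pg i)).
have JE : dot g g = J oOmega f by exact: gP.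
have J0 : 0 <= J oOmega f by rewrite -JE; exact: semi_inner_ge0 semi_inner_dot _ Lg.
(* Along test functions tending to [green oOmega f], both the inner product with [f] and the energy
   tend to [J oOmega f]; one factor can then be cancelled. *)
have JJ : J oOmega f ^+ 2 <= M * J oOmega f.
  have l3 : (fun k => inner (phi k) f ^+ 2) @ \oo --> J oOmega f ^+ 2.
    by rewrite /J (semi_innerC hL Lf Lu); apply: cvgM.
  have l4 : (fun k => M * energy (phi k) (phi k)) @ \oo --> M * J oOmega f.
    by apply: cvgM; [exact: cvg_cst|rewrite -JE].
  rewrite -(cvg_lim _ l3)// -(cvg_lim _ l4)//; apply: ler_lim.
  - by apply/cvg_ex; eexists; exact: l3.
  - by apply/cvg_ex; eexists; exact: l4.
  by apply: nearW => k; rewrite (semi_innerC hL _ Lf) ?H//; exact: L2t.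
have [->//|Jn0] := eqVneq (J oOmega f) 0.
by move: JJ; rewrite expr2 ler_pM2r// lt_neqAle eq_sym Jn0.
Qed.

(** Cauchy-Schwarz and the Poincare inequality verify the hypothesis of [J_le] with
    [M = C * inner f f]. *)
Lemma J_bounded : exists2 K, 0 < K & forall f, L2 f -> J oOmega f <= K * inner f f.
Proof.
have [C C0 poinc] := poincare oOmega bOmega i0; exists C => // f Lf.
have f0 := semi_inner_ge0 hL Lf.
apply: J_le => // [|phi tp]; first by rewrite mulr_ge0// ltW.
apply: le_trans (semi_inner_cauchy_schwarz sL hL Lf (L2t tp)) _.
rewrite [X in _ <= X * _]mulrC -mulrA; apply: ler_wpM2l => //.
exact: poinc.
Qed.

End green_operator.

(** * Compactness *)

Section boxes.
Context {R : realType} {d : nat}.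
Implicit Types (b x y : 'rV[R]_d) (r : R).
Local Notation lambda := (lebesgue_rV d).

(** Half-open, so that the boxes of a grid are disjoint and leave no gaps. *)
Definition box b r := [set x : 'rV[R]_d |
  forall i, `[b ord0 i, b ord0 i + r[%classic (x ord0 i)].

Lemma boxP b r x : box b r x <-> forall i, b ord0 i <= x ord0 i < b ord0 i + r.
Proof. by split=> + i => /(_ i); rewrite /= in_itv. Qed.

Lemma lebesgue_box b r : 0 <= r -> lambda (box b r) = (r ^+ d)%:E.
Proof.
move=> r0; rewrite (@lebesgue_rV_box R d (fun i => `[b ord0 i, b ord0 i + r[%classic)); last first.
  by move=> i; exact: measurable_itv.
under eq_bigr => i _ do rewrite lebesgue_measure_itv/= lte_fin.
rewrite (eq_bigr (fun=> r%:E)); last first.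
  move=> i _; rewrite ltrDl; case: ltP => [_|r0'].
    by rewrite -!EFinD; congr EFin; ring.
  by congr EFin; apply/eqP; rewrite eq_le r0.
by rewrite prodEFin big_const_ord iter_mulr_1.
Qed.

Lemma measurable_box b r : measurable (box b r).
Proof.
rewrite (_ : box b r = \bigcap_(i in [set: 'I_d])
   ((fun x : 'rV[R]_d => x ord0 i) @^-1` `[b ord0 i, b ord0 i + r[)).
  apply: fin_bigcap_measurable => // i _; rewrite -[X in measurable X]setTI.
  by apply: measurable_rV_coord => //; exact: measurable_itv.
by apply/seteqP; split => x Bx i; [move=> _; exact: Bx|exact: (Bx i I)].
Qed.

Lemma box_dist b r x y : 0 <= r -> box b r x -> box b r y -> `|y - x| <= r.
Proof.
move=> r0 /boxP Bx /boxP By; apply/(mx_norm_leP _ r0) => i; rewrite !mxE ler_norml.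
have /andP[h1 h2] := By i; have /andP[h3 h4] := Bx i.
by apply/andP; split; lra.
Qed.

(** The side is [3 * r] because a half-open box of side [2 * r] would miss the upper faces of the
    closed ball. *)
Lemma ball_sub_box r : 0 < r ->
  [set z : 'rV[R]_d | `|z| <= r] `<=` box (const_mx (- r)) (3 * r).
Proof.
move=> r0 z /= /(mx_norm_leP _ (ltW r0)) zr; apply/boxP => i; rewrite mxE.
by have := zr i; rewrite ler_norml => /andP[h1 h2]; apply/andP; split; lra.
Qed.

(** The index of the cell of [x] is the integer part of [(x ord0 i + M) / r] in each coordinate; its
    uniqueness is the disjointness of the cells. *)
Lemma finite_grid (M r : R) : 0 < r -> exists (K : finType) (b : K -> 'rV[R]_d),
  (forall x, `|x| <= M -> exists k, box (b k) r x) /\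
  (forall k k' x, box (b k) r x -> box (b k') r x -> k = k').
Proof.
move=> r0; pose N := Num.truncn (2 * M / r).
pose b (k : {ffun 'I_d -> 'I_N.+1}) : 'rV[R]_d := \row_i (- M + (k i)%:R * r).
have bE k x : box (b k) r x <->
    forall i, (k i)%:R <= (x ord0 i + M) / r < (k i).+1%:R.
  rewrite boxP; split=> + i => /(_ i); rewrite mxE ler_pdivlMr// ltr_pdivrMr//.
    by move=> /andP[h1 h2]; apply/andP; split; rewrite -?natr1; lra.
  by rewrite -natr1 => /andP[h1 h2]; apply/andP; split; lra.
exists {ffun 'I_d -> 'I_N.+1}, b; split=> [x xM|k k' x].
  have M0 : 0 <= M := le_trans (normr_ge0 _) xM.
  have xi i : 0 <= (x ord0 i + M) / r <= 2 * M / r.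
    have /(mx_norm_leP _ M0)/(_ i) := xM; rewrite ler_norml => /andP[h1 h2].
    by rewrite divr_ge0 ?(ltW r0)//= ?ler_pM2r ?invr_gt0//; lra.
  exists [ffun i => inord (Num.truncn ((x ord0 i + M) / r))]; apply/bE => i.
  have /andP[h1 h2] := xi i.
  rewrite ffunE inordK; first exact: truncn_itv.
  by rewrite ltnS; exact: le_truncn.
move=> /bE h /bE h'; apply/ffunP => i; apply: val_inj.
by rewrite /= -(truncn_def (h i)) -(truncn_def (h' i)).
Qed.

End boxes.

Section compactness.
Context {R : realType} {d : nat} {Omega : set 'rV[R]_d}.
Context (oOmega : open Omega) (bOmega : bounded_set Omega).
Implicit Types (f u v w phi psi : 'rV[R]_d -> R).
Implicit Types (i : 'I_d) (x y z : 'rV[R]_d).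
Local Notation test := (test_function Omega).
Local Notation mu := (lebesgue_on oOmega).
Local Notation lambda := (lebesgue_rV d).
Local Notation L2 := (L2 oOmega).
Local Notation inner := (inner oOmega).

Let sL : subspace L2 := L2_subspace oOmega.
Let hL : semi_inner L2 inner := semi_inner_inner oOmega.
Let muoo := lebesgue_on_lty oOmega bOmega.

Lemma measurable_increment phi (r : R) : measurable_fun setT phi ->
  measurable_fun setT (fun p : 'rV[R]_d * 'rV[R]_d =>
    (\1_[set z : 'rV[R]_d | `|z| <= r] (p.2 - p.1) * `|phi p.2 - phi p.1|)%:E).
Proof.
move=> mp; apply/measurable_EFinP; apply: measurable_funM.
  apply: (measurableT_comp (measurable_indic (measurable_rV_ball r))).
  apply: measurable_rV_add; first exact: measurable_snd.
  apply: measurable_fun_rVP => i; under eq_fun do rewrite mxE.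
  apply: measurableT_comp => //.
  exact: (measurableT_comp (measurable_rV_coord i) measurable_fst).
apply: measurableT_comp => //; apply: measurable_funB.
  by apply: (measurableT_comp mp); exact: measurable_snd.
by apply: (measurableT_comp mp); exact: measurable_fst.
Qed.

(** Substitute [y = x + z] and exchange the integrals: for fixed [z] in the ball,
    [test_function_increment_le] applies with coordinates at most [r], and the ball has measure at
    most [(3 * r) ^+ d]. *)
Lemma double_increment_le phi (r : R) : test phi -> 0 < r ->
  (\int[lambda]_x \int[lambda]_y
     (\1_[set z : 'rV[R]_d | (`|z| <= r)%R] (y - x)%R * `|phi y - phi x|%R)%:E
   <= ((3 * r) ^+ d * (r * \sum_i \int[mu]_x `|partial i phi x|))%:E)%E.
Proof.
move=> tp r0; set B := [set z : 'rV[R]_d | `|z| <= r].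
have mB : measurable B := measurable_rV_ball r.
have mp := test_function_measurable tp.
pose F (p : 'rV[R]_d * 'rV[R]_d) : \bar R := (\1_B p.2 * `|phi (p.1 + p.2) - phi p.1|)%:E.
have mF : measurable_fun setT F.
  apply/measurable_EFinP; apply: measurable_funM.
    by apply: (measurableT_comp (measurable_indic mB)); exact: measurable_snd.
  apply: measurableT_comp => //; apply: measurable_funB.
    apply: (measurableT_comp mp).
    by apply: measurable_rV_add; [exact: measurable_fst|exact: measurable_snd].
  by apply: (measurableT_comp mp); exact: measurable_fst.
have F0 p : (0 <= F p)%E by rewrite lee_fin mulr_ge0.
set S := \sum_i _.
have S0 : 0 <= S by apply: sumr_ge0 => i _; exact: Rintegral_ge0.
rewrite (_ : (\int[lambda]_x _)%E = (\int[lambda]_x \int[lambda]_z F (x, z))%E); last first.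
  apply: eq_integral => x _.
  rewrite -(@ge0_integral_shift R d x
    (fun y => (\1_B (y - x) * `|phi y - phi x|)%:E)) => [|//|y].
  - by apply: eq_integral => z _; rewrite addrK [(z + x)%R]addrC.
  - apply/measurable_EFinP; apply: measurable_funM.
      exact: (measurableT_comp (measurable_indic mB) (measurable_shift_rV (- x))).
    by apply: measurableT_comp => //; apply: measurable_funB.
  - by rewrite lee_fin mulr_ge0.
rewrite fubini_tonelli//.
apply: (@le_trans _ _ (\int[lambda]_z (r * S * \1_B z)%:E)%E).
  apply: ge0_le_integral => //.
  - by move=> z _; apply: integral_ge0.
  - exact: measurable_fun_fubini_tonelli_G.
  - by apply/measurable_EFinP; apply: measurable_funM => //; exact: measurable_indic.
  move=> z _; rewrite /F/= indicE; have [zB|zB] := boolP (z \in B); last first.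
    by rewrite mulr0; under eq_integral do rewrite mul0r; rewrite integral0.
  under eq_integral do rewrite mul1r.
  apply: le_trans (test_function_increment_le oOmega bOmega z tp) _.
  rewrite lee_fin mulr1 /S mulr_sumr; apply: ler_sum => i _.
  apply: ler_wpM2r; first exact: Rintegral_ge0.
  by move: zB; rewrite inE => /(mx_norm_leP _ (ltW r0)).
under eq_integral do rewrite EFinM.
rewrite ge0_integralZl_EFin ?mulr_ge0 ?(ltW r0)//; last first.
  by apply/measurable_EFinP; exact: measurable_indic.
rewrite integral_indic// setIT [leRHS]EFinM [leLHS]muleC.
rewrite lee_wpmul2r ?lee_fin ?mulr_ge0 ?(ltW r0)//.
rewrite -(lebesgue_box (const_mx (- r))) ?mulr_ge0 ?(ltW r0)//.
by apply: le_measure; rewrite ?inE//; [exact: measurable_box|exact: ball_sub_box].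
Qed.

Section cells.
Context (K : finType) (b : K -> 'rV[R]_d) (r : R).
Context (r0 : 0 < r) (cover : forall x, Omega x -> exists k, box (b k) r x).
Context (disj : forall k k' x, box (b k) r x -> box (b k') r x -> k = k').
Local Notation Q k := (box (b k) r).
Local Notation S phi := (\sum_i \int[mu]_x `|partial i phi x|).

Let mQ k : measurable (Q k) := measurable_box (b k) r.

Let lQ k : lambda (Q k) = (r ^+ d)%:E.
Proof. by apply: lebesgue_box; exact: ltW. Qed.

Let Qoo k : (lambda (Q k) < +oo)%E.
Proof. by rewrite lQ ltry. Qed.

Lemma sum_indic_cells x k : Q k x -> \sum_k' \1_(Q k') x = 1 :> R.
Proof.
move=> Qx; rewrite (bigD1 k)//= big1 ?addr0; first by rewrite indicE mem_set.
move=> k' kk'; rewrite indicE memNset// => Qx'.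
by move: kk'; rewrite (disj Qx Qx') eqxx.
Qed.

Lemma sum_indic_cellsM phi x : test phi -> \sum_k \1_(Q k) x * phi x = phi x.
Proof.
move=> tp; have [/cover[k Qx]|nOx] := pselect (Omega x).
  by rewrite -mulr_suml (sum_indic_cells Qx) mul1r.
by rewrite (test_function_eq0 tp nOx) big1// => k _; rewrite mulr0.
Qed.

Let cell_integrable phi k (c : R) : test phi ->
  lambda.-integrable (Q k) (EFin \o (fun y => c - phi y)).
Proof.
move=> tp; have [C C0 pC] := test_function_bounded tp.
apply: measurable_bounded_integrable => //.
- exact: Qoo.
- by apply: measurable_funTS; apply: measurable_funB => //; exact: test_function_measurable tp.
apply: (@bounded_onP _ _ _ _ (`|c| + C)) => y _.
by apply: le_trans (ler_normB _ _) _; rewrite lerD2l.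
Qed.

Let cell_integrable0 phi k : test phi -> lambda.-integrable (Q k) (EFin \o phi).
Proof.
move=> tp; have := integrableN (cell_integrable k 0 tp).
by apply: eq_integrable => // y _ /=; rewrite sub0r opprK.
Qed.

Definition cell_integral phi k := \int[lambda]_(y in Q k) phi y.

Lemma sum_cell_integral_le phi : test phi ->
  \sum_k `|cell_integral phi k| <= \int[mu]_x `|phi x|.
Proof.
move=> tp; rewrite -lee_fin integral_norm_test_function// -sumEFin.
have mp := test_function_measurable tp.
have mk k : measurable_fun setT (fun y => (\1_(Q k) y * `|phi y|)%:E).
  apply/measurable_EFinP; apply: measurable_funM; first exact: measurable_indic.
  exact: measurableT_comp.
apply: (@le_trans _ _ (\sum_k \int[lambda]_y (\1_(Q k) y * `|phi y|)%:E)%E).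
  apply: lee_sum => k _.
  have Ip := cell_integrable0 k tp.
  apply: (@le_trans _ _ (\int[lambda]_(y in Q k) `|phi y|)%:E).
    by rewrite lee_fin; exact: le_normr_Rintegral.
  rewrite fineK; last by apply: integrable_fin_num => //; exact: integrable_norm.
  rewrite integral_mkcond le_eqVlt; apply/orP; left; apply/eqP.
  apply: eq_integral => y _; rewrite patchE indicE; case: ifP => _;
    by rewrite ?mul1r ?mul0r.
rewrite -ge0_integral_sum//.
rewrite le_eqVlt; apply/orP; left; apply/eqP; apply: eq_integral => y _.
rewrite sumEFin; congr EFin.
have [/cover[k Qy]|nOy] := pselect (Omega y).
  by rewrite -mulr_suml (sum_indic_cells Qy) mul1r.
by rewrite (test_function_eq0 tp nOy) normr0 big1// => k _; rewrite mulr0.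
Qed.

(** The deviation of [phi] from its mean on the cell, multiplied by the volume [r ^+ d] of the cell
    to avoid a division. *)
Definition cell_deviation phi k : 'rV[R]_d -> R :=
  fun x => \1_(Q k) x * (r ^+ d * phi x - cell_integral phi k).

Lemma cell_deviation_measurable phi k : test phi ->
  measurable_fun setT (cell_deviation phi k).
Proof.
move=> tp; apply: measurable_funM; first exact: measurable_indic.
by apply: measurable_funB => //; apply: measurable_funM => //; exact: test_function_measurable tp.
Qed.

Lemma cell_deviation_L2 phi k : test phi -> L2 (cell_deviation phi k).
Proof.
move=> tp; have [C C0 pC] := test_function_bounded tp.
apply: (@sqint_bounded _ _ _ _ muoo _ (r ^+ d * C + `|cell_integral phi k|)).
  exact: cell_deviation_measurable.
have c0 : 0 <= r ^+ d * C + `|cell_integral phi k|.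
  by rewrite addr_ge0// mulr_ge0// exprn_ge0// ltW.
apply: aeW => x; rewrite /cell_deviation indicE; case: (x \in _); last first.
  by rewrite mul0r normr0.
rewrite mul1r; apply: le_trans (ler_normB _ _) _; rewrite lerD2r normrM.
by rewrite ger0_norm ?exprn_ge0 ?(ltW r0)// ler_wpM2l// exprn_ge0// ltW.
Qed.

(** For [x] in a cell, the deviation is the integral of [phi x - phi y] over [y] in the same cell.
    Points of one cell are at distance at most [r], so the sum over the cells is controlled by
    [double_increment_le]. *)
Lemma sum_cell_deviation_le phi : test phi ->
  \sum_k \int[mu]_x `|cell_deviation phi k x| <= (3 * r) ^+ d * (r * S phi).
Proof.
move=> tp; have mp := test_function_measurable tp.
rewrite -lee_fin -sumEFin; apply: le_trans _ (double_increment_le tp r0).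
pose G k x y := (\1_(Q k) x * (\1_(Q k) y * `|phi y - phi x|))%:E.
have G0 k x y : (0 <= G k x y)%E by rewrite lee_fin !mulr_ge0.
have mG k x : measurable_fun setT (G k x).
  apply/measurable_EFinP; apply: measurable_funM => //; apply: measurable_funM.
    exact: measurable_indic.
  by apply: measurableT_comp => //; exact: measurable_funB.
have mG2 k : measurable_fun setT (fun p : 'rV[R]_d * 'rV[R]_d => G k p.1 p.2).
  apply/measurable_EFinP; apply: measurable_funM.
    by apply: (measurableT_comp (measurable_indic (mQ k))); exact: measurable_fst.
  apply: measurable_funM.
    by apply: (measurableT_comp (measurable_indic (mQ k))); exact: measurable_snd.
  apply: measurableT_comp => //; apply: measurable_funB.
    by apply: (measurableT_comp mp); exact: measurable_snd.
  by apply: (measurableT_comp mp); exact: measurable_fst.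
have mIG k : measurable_fun setT (fun x => \int[lambda]_y G k x y)%E.
  by have := @measurable_fun_fubini_tonelli_F _ _ _ _ _ lambda _ (mG2 k) (fun p => G0 k p.1 p.2).
have dev k x : (`|cell_deviation phi k x|%:E <= \int[lambda]_y G k x y)%E.
  rewrite /cell_deviation /G normrM indicE; have [Qx|Qx] := boolP (x \in Q k); last first.
    rewrite normr0 mul0r; apply: integral_ge0 => y _.
    by rewrite lee_fin !mulr_ge0.
  rewrite normr1 mul1r.
  have -> : r ^+ d * phi x - cell_integral phi k = \int[lambda]_(y in Q k) (phi x - phi y).
    have rd : r ^+ d * phi x = \int[lambda]_(y in Q k) phi x.
      by rewrite Rintegral_cst// [X in fine X]lQ mulrC.
    rewrite rd /cell_integral RintegralB//; last exact: cell_integrable0.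
    apply: measurable_bounded_integrable => //.
      exact: Qoo.
    exact: (@bounded_onP _ _ _ _ `|phi x|).
  have Ip := cell_integrable k (phi x) tp.
  apply: (@le_trans _ _ (\int[lambda]_(y in Q k) `|phi x - phi y|)%:E).
    by rewrite lee_fin; exact: le_normr_Rintegral.
  rewrite fineK; last by apply: integrable_fin_num => //; exact: integrable_norm.
  rewrite integral_mkcond le_eqVlt; apply/orP; left; apply/eqP.
  apply: eq_integral => y _; rewrite patchE indicE mul1r distrC; case: ifP => _;
    by rewrite ?mul1r ?mul0r.
apply: (@le_trans _ _ (\sum_k \int[lambda]_x \int[lambda]_y G k x y)%E).
  apply: lee_sum => k _.
  have mdev : measurable_fun setT (fun x => `|cell_deviation phi k x|%:E).
    by apply/measurable_EFinP; apply: measurableT_comp => //; exact: cell_deviation_measurable.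
  rewrite fineK; last first.
    apply: integrable_fin_num => //; apply: integrable_norm.
    by apply: sqint_integrable; [exact: muoo|exact: cell_deviation_L2].
  rewrite [leLHS](@ge0_integral_mrestr _ _ _ lambda _ (open_measurable_rV oOmega)
    (fun x => `|cell_deviation phi k x|%:E))//.
  apply: le_trans (_ : (_ <= \int[lambda]_x `|cell_deviation phi k x|%:E)%E) _.
    by apply: ge0_subset_integral => //; exact: open_measurable_rV.
  by apply: ge0_le_integral => // x _; exact: dev.
rewrite -ge0_integral_sum//; last by move=> k x _; exact: integral_ge0.
apply: ge0_le_integral => //.
- by move=> x _; apply: sume_ge0 => k _; exact: integral_ge0.
- exact: emeasurable_sum.
- apply: (@measurable_fun_fubini_tonelli_F _ _ _ _ _ lambda _ (measurable_increment r mp)).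
  by move=> p; rewrite lee_fin mulr_ge0.
move=> x _; rewrite -ge0_integral_sum//.
apply: ge0_le_integral => //.
- by move=> y _; apply: sume_ge0 => k _.
- exact: emeasurable_sum.
- exact: (measurableT_comp (measurable_increment r mp) (pair1_measurable x)).
move=> y _; rewrite sumEFin lee_fin.
under eq_bigr do rewrite mulrA.
rewrite -mulr_suml; apply: ler_wpM2r => //.
(* At most one cell contains both points, so the sum of products of indicators is 0 or 1. *)
have [[k [Qx Qy]]|nQ] := pselect (exists k, Q k x /\ Q k y); last first.
  rewrite big1// => k _; rewrite !indicE.
  have [Qx|] := boolP (x \in Q k); last by rewrite mul0r.
  have [Qy|] := boolP (y \in Q k); last by rewrite mulr0.
  by exfalso; apply: nQ; exists k; rewrite !inE in Qx Qy.
rewrite (bigD1 k)//= big1 ?addr0; last first.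
  move=> k' kk'; rewrite !indicE (_ : x \in Q k' = false) ?mul0r//.
  apply/negP; rewrite inE => Qx'; move: kk'; by rewrite (disj Qx Qx') eqxx.
by rewrite !indicE !mem_set// ?mulr1//=; exact: box_dist (ltW r0) Qx Qy.
Qed.

(** This is where [|w| <= 1] lets L^1 estimates on test functions suffice. *)
Lemma inner_le_integral_norm w phi : L2 w -> {ae mu, forall x, `|w x| <= 1} ->
  L2 phi -> `|inner w phi| <= \int[mu]_x `|phi x|.
Proof.
move=> Lw w1 Lp; have Iwp := sqintM Lw Lp.
have Ip := integrable_norm (sqint_integrable muoo Lp).
apply: le_trans (le_normr_Rintegral measurableT Iwp) _.
rewrite fine_le//; [exact/integrable_fin_num/integrable_norm|exact: integrable_fin_num|].
apply: ae_ge0_le_integral => //.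
- exact: measurable_int (integrable_norm Iwp).
- exact: measurable_int Ip.
by apply: filterS w1 => x wx _; rewrite lee_fin normrM ler_piMl.
Qed.

Lemma indic_cell_L2 k : L2 \1_(Q k).
Proof.
apply: (@sqint_bounded _ _ _ _ muoo _ 1); first exact: measurable_indic.
by apply: aeW => x; rewrite indicE; case: (_ \in _); rewrite ?normr1 ?normr0.
Qed.

(* On a cell, [phi] is within [r * |partial phi|_1] of its mean in L^1, and the
   mean of [phi] only sees the integral of [w] over the cell. *)
Lemma cell_average w phi (eta : R) : 0 <= eta -> L2 w -> {ae mu, forall x, `|w x| <= 1} ->
  test phi -> (forall k, `|inner w \1_(Q k)| <= eta) ->
  r ^+ d * `|inner w phi| <=
  eta * \int[mu]_x `|phi x| + (3 * r) ^+ d * (r * S phi).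
Proof.
move=> eta0 Lw w1 tp weta.
have Lp := test_function_L2 oOmega bOmega tp.
(* The cell integrals cancel in each summand, and what remains is [r ^+ d *: phi] cut up by the
   indicators of the cells. *)
have E : r ^+ d *: phi = \sum_k (cell_integral phi k *: \1_(Q k) + cell_deviation phi k).
  apply/funext => x; rewrite fct_sumE -[LHS]/(r ^+ d * phi x).
  rewrite -{1}(sum_indic_cellsM x tp) mulr_sumr; apply: eq_bigr => k _.
  rewrite -[RHS]/(cell_integral phi k * \1_(Q k) x + cell_deviation phi k x).
  by rewrite /cell_deviation; ring.
have Lk k := indic_cell_L2 k; have Ld k := cell_deviation_L2 k tp.
have Lc k : L2 (cell_integral phi k *: \1_(Q k)) by exact: (subspaceZ sL).
have rd0 : 0 <= r ^+ d by rewrite exprn_ge0// ltW.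
rewrite -[X in X * _](ger0_norm rd0) -normrM -(semi_innerZr sL hL)// E.
rewrite (semi_inner_sumr sL hL)//; last by move=> k; exact: (subspaceD sL).
under eq_bigr do rewrite (semi_innerDr sL hL)// (semi_innerZr sL hL)//.
rewrite big_split/=; apply: le_trans (ler_normD _ _) _; apply: lerD.
  apply: le_trans (ler_norm_sum _ _ _) _.
  apply: le_trans (_ : _ <= \sum_k eta * `|cell_integral phi k|) _.
    by apply: ler_sum => k _; rewrite normrM mulrC ler_wpM2r.
  by rewrite -mulr_sumr ler_wpM2l ?sum_cell_integral_le.
apply: le_trans (ler_norm_sum _ _ _) _; apply: le_trans (sum_cell_deviation_le tp).
by apply: ler_sum => k _; exact: inner_le_integral_norm.
Qed.

End cells.

End compactness.

(** * Total boundedness for the Green form and existence of the maximizer *)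

Section maximizer.
Context {R : realType} {d : nat} {Omega : set 'rV[R]_d}.
Context (oOmega : open Omega) (bOmega : bounded_set Omega) (i0 : 'I_d).
Implicit Types (f u v w phi psi : 'rV[R]_d -> R).
Implicit Types (i : 'I_d) (x y z : 'rV[R]_d).
Local Notation test := (test_function Omega).
Local Notation mu := (lebesgue_on oOmega).
Local Notation L2 := (L2 oOmega).
Local Notation inner := (inner oOmega).
Local Notation energy phi := (dot oOmega (grad phi) (grad phi)).

Let sL : subspace L2 := L2_subspace oOmega.
Let hL : semi_inner L2 inner := semi_inner_inner oOmega.
Let muoo := lebesgue_on_lty oOmega bOmega.

Lemma integral_norm_sqr_le f : L2 f ->
  (\int[mu]_x `|f x|) ^+ 2 <= fine (mu setT) * inner f f.
Proof.
move=> Lf.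
have mf : measurable_fun setT (fun x => `|f x|).
  by apply: measurableT_comp => //; exact: sqint_measurable Lf.
have [Ln nf] : L2 (fun x => `|f x|) /\
    inner (fun x => `|f x|) (fun x => `|f x|) <= inner f f.
  by apply: sqint_le => //; apply: aeW => x; rewrite normr_id.
have L1 : L2 (cst 1) by exact: sqint_cst.
have := semi_inner_cauchy_schwarz sL hL Ln L1.
have -> : inner (cst 1) (cst 1) = fine (mu setT).
  rewrite -[RHS]mul1r -Rintegral_cst//.
  by apply: eq_Rintegral => x _; rewrite mulr1.
have -> : inner (fun x => `|f x|) (cst 1) = \int[mu]_x `|f x|.
  by apply: eq_Rintegral => x _; rewrite mulr1.
move=> /le_trans; apply; rewrite mulrC ler_wpM2l// fine_ge0//.
Qed.

Definition unit_valued f := L2 f /\ {ae mu, forall x, 0 <= f x <= 1}.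

(** The colour of [f] records its integrals over the cells of a grid, rounded to multiples of [eta].
    For equal colours the difference [w] has integrals at most [eta] over the cells, [cell_average]
    bounds its products with test functions by [s] times the root of the energy, and [J_le]
    concludes with [s ^+ 2 = e]. *)
Lemma green_totally_bounded (e : R) : 0 < e -> exists (I : finType)
  (c : ('rV[R]_d -> R) -> I), forall f f', unit_valued f -> unit_valued f' ->
  c f = c f' -> green_form oOmega (f - f') (f - f') <= e.
Proof.
move=> e0; have [C C0 poinc] := poincare oOmega bOmega i0.
have [M M0 OM] := bounded_domainP bOmega.
pose m := fine (mu setT); have m0 : 0 <= m by exact: fine_ge0.
pose s := Num.sqrt e; have s0 : 0 < s by rewrite sqrtr_gt0.
pose a := Num.sqrt (m * C); pose b := Num.sqrt m.
have a0 : 0 <= a := sqrtr_ge0 _; have b0 : 0 <= b := sqrtr_ge0 _.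
(* [a] and [b] bound the L^1 norms of a test function and of its partial derivatives in terms of the
   root of the energy. [r] and [eta] are chosen to give each of the two terms of [cell_average] half
   of the allowance [r ^+ d * s]; the added 1 in [B] and in [a + 1] keeps the denominators
   positive. *)
pose B := 3 ^+ d * (d%:R * b) + 1.
have B0 : 0 < B by rewrite ltr_wpDl// !mulr_ge0// exprn_ge0.
pose r := s / 2 / B; have r0 : 0 < r by rewrite !divr_gt0.
have rd0 : 0 < r ^+ d by rewrite exprn_gt0.
pose eta := s / 2 * r ^+ d / (a + 1).
have eta0 : 0 < eta by rewrite divr_gt0 ?mulr_gt0 ?divr_gt0// ltr_wpDl.
have [K [q [cov disj]]] := @finite_grid R d M r r0.
have cover x : Omega x -> exists k, box (q k) r x by move=> /OM/cov.
(* The integrals lie between [- m] and [m], so after the shift by [m] the rounded values range from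
   0 to [N]. *)
pose N := Num.truncn (2 * m / eta).
pose avg f k := inner f \1_(box (q k) r).
pose c f : {ffun K -> 'I_N.+1} :=
  [ffun k => inord (Num.truncn ((avg f k + m) / eta))].
exists {ffun K -> 'I_N.+1}, c => f f' [Lf f01] [Lf' f'01] cff'.
pose w := f - f'; have Lw : L2 w by exact: (subspaceB sL).
have ae1 g : {ae mu, forall x, 0 <= g x <= 1} -> {ae mu, forall x, `|g x| <= 1}.
  by apply: filterS => x /andP[g0 g1]; rewrite ger0_norm.
have w1 : {ae mu, forall x, `|w x| <= 1}.
  apply: filterS2 f01 f'01 => x /andP[h1 h2] /andP[h3 h4].
  by rewrite -[w x]/(f x - f' x) ler_norml; apply/andP; split; lra.
have Lk k : L2 \1_(box (q k) r) by exact: indic_cell_L2.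
have avg_le g k : L2 g -> {ae mu, forall x, 0 <= g x <= 1} ->
    0 <= (avg g k + m) / eta <= 2 * m / eta.
  move=> Lg /ae1 g1; have := inner_le_integral_norm bOmega Lg g1 (Lk k).
  have : \int[mu]_x `|\1_(box (q k) r) x| <= m.
    rewrite -[leRHS]mul1r -Rintegral_cst//; apply: le_Rintegral => //.
    - exact: integrable_norm (sqint_integrable muoo (Lk k)).
    - exact: (sqint_integrable muoo (sqint_cst muoo 1)).
    - by move=> x _; rewrite indicE; case: (_ \in _); rewrite ?normr1 ?normr0.
  rewrite -/(avg g k) => h1 /le_trans/(_ h1); rewrite ler_norml => /andP[h2 h3].
  by rewrite divr_ge0 ?(ltW eta0)//= ?ler_pM2r ?invr_gt0//; lra.
have weta k : `|inner w \1_(box (q k) r)| <= eta.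
  have -> : inner w \1_(box (q k) r) = avg f k - avg f' k.
    have [_ H _] := hL; rewrite /w addrC -scaleN1r (H (-1) _ _ _ Lf' Lf (Lk k)) /avg; ring.
  have /andP[p1 p2] := avg_le _ k Lf f01; have /andP[p3 p4] := avg_le _ k Lf' f'01.
  (* Equal integer parts: the quotients differ by less than 1, hence the integrals by less than
     [eta]. *)
  have := congr1 (fun g : {ffun K -> 'I_N.+1} => val (g k)) cff'.
  rewrite /c !ffunE /= !inordK ?ltnS ?le_truncn// => tt.
  have := truncn_itv p1; have := truncn_itv p3; rewrite tt.
  move: (Num.truncn _) => n /andP[].
  rewrite ler_pdivlMr// ltr_pdivrMr// -natr1 => u1 u2 /andP[].
  rewrite ler_pdivlMr// ltr_pdivrMr// => u3 u4.
  by rewrite ler_norml; apply/andP; split; lra.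
have -> : green_form oOmega (f - f') (f - f') = J oOmega w by [].
apply: (J_le bOmega i0 Lw (ltW e0)) => phi tp.
have Lp : L2 phi by exact: test_function_L2.
have := cell_average bOmega r0 cover disj (ltW eta0) Lw w1 tp weta.
have E0 : 0 <= energy phi := semi_inner_ge0 (semi_inner_energy oOmega bOmega) tp.
pose X := Num.sqrt (energy phi); have X0 : 0 <= X := sqrtr_ge0 _.
(* Cauchy-Schwarz against the constant 1, followed by the Poincare inequality. *)
have n1 : \int[mu]_x `|phi x| <= a * X.
  rewrite -sqrtrM ?mulr_ge0 ?(ltW C0)// -[leLHS]ger0_norm ?Rintegral_ge0//.
  rewrite -sqrtr_sqr ler_wsqrtr// -mulrA.
  apply: le_trans (integral_norm_sqr_le Lp) _; rewrite ler_wpM2l//.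
  exact: poinc.
have ni i : \int[mu]_x `|partial i phi x| <= b * X.
  have Li : L2 (partial i phi) by exact: grad_L2.
  rewrite -sqrtrM// -[leLHS]ger0_norm ?Rintegral_ge0//.
  rewrite -sqrtr_sqr ler_wsqrtr//.
  apply: le_trans (integral_norm_sqr_le Li) _; rewrite ler_wpM2l//.
  rewrite /dot (bigD1 i)//= lerDl sumr_ge0// => j _.
  by apply: (semi_inner_ge0 hL); exact: grad_L2.
have nS : \sum_i \int[mu]_x `|partial i phi x| <= d%:R * b * X.
  apply: le_trans (ler_sum _ (fun i _ => ni i)) _.
  by rewrite sumr_const card_ord -mulrA mulr_natl.
have key : eta * (a * X) + (3 * r) ^+ d * (r * (d%:R * b * X)) <= r ^+ d * (s * X).
  have -> : r ^+ d * (s * X) = r ^+ d * (s / 2 * X) + r ^+ d * (s / 2 * X) by field.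
  apply: lerD.
    have -> : eta * (a * X) = r ^+ d * (s / 2 * X) * (a / (a + 1)).
      by rewrite /eta; field; rewrite gt_eqF// ltr_wpDl.
    apply: ler_piMr; first by rewrite !mulr_ge0 ?(ltW rd0) ?(ltW s0).
    by rewrite ler_pdivrMr ?ltr_wpDl// mul1r lerDl.
  have rB : r * (3 ^+ d * (d%:R * b)) <= s / 2.
    by rewrite /r mulrAC ler_pdivrMr// ler_pM2l ?divr_gt0// lerDl.
  have -> : (3 * r) ^+ d * (r * (d%:R * b * X)) = r ^+ d * (r * (3 ^+ d * (d%:R * b)) * X).
    by rewrite exprMn; ring.
  by rewrite ler_wpM2l ?(ltW rd0)// ler_wpM2r.
move=> h; have {}h : `|inner w phi| <= s * X.
  rewrite -(ler_pM2l rd0); apply: le_trans h _; apply: le_trans key.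
  apply: lerD; first by rewrite ler_wpM2l// ltW.
  have r3 : 0 <= (3 * r) ^+ d by rewrite exprn_ge0// mulr_ge0// ltW.
  by apply: ler_wpM2l => //; apply: ler_wpM2l => //; exact: ltW.
rewrite -real_normK ?num_real//.
have -> : e * energy phi = (s * X) ^+ 2.
  by rewrite exprMn !sqr_sqrtr// ltW.
by rewrite lerXn2r// nnegrE mulr_ge0// ltW.
Qed.

(** [g] is [f] minus its truncation to the interval from 0 to 1. As the values of [x k] lie in this
    interval almost everywhere, [|g| <= |f - x k|], so [g] has norm zero; no almost everywhere
    convergent subsequence has to be extracted. *)
Lemma unit_valued_limit (x : nat -> 'rV[R]_d -> R) f : (forall k, unit_valued (x k)) ->
  L2 f -> limit (fun u => inner u u) x f -> unit_valued f.
Proof.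
move=> ux Lf xf; split=> //.
pose g := fun y => f y - Num.max 0 (Num.min 1 (f y)).
have mf : measurable_fun setT f := sqint_measurable Lf.
have mg : measurable_fun setT g.
  apply: measurable_funB => //; apply: measurable_maxr => //.
  exact: measurable_minr.
have Lxf k : L2 (f - x k) by apply: (subspaceB sL) => //; exact: (ux k).1.
have gk k : L2 g /\ inner g g <= inner (f - x k) (f - x k).
  apply: sqint_le => //; first exact: Lxf.
  apply: filterS (ux k).2 => y /andP[h1 h2]; rewrite /g -[(f - x k) y]/(f y - x k y).
  have [f1|f1] := leP 1 (f y).
    by rewrite max_r// ger0_norm ?subr_ge0// ger0_norm; lra.
  have [f0|f0] := leP 0 (f y); first by rewrite subrr normr0.
  by rewrite subr0 !ltr0_norm; lra.
have g0 : inner g g = 0.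
  apply/eqP; rewrite eq_le (semi_inner_ge0 hL (gk 0%N).1) andbT.
  apply/ler_addgt0Pr => e e0; rewrite add0r; have [N /(_ N (leqnn N)) xN] := xf _ e0.
  by apply: le_trans (gk N).2 _; rewrite (semi_inner_sqBC sL hL)//; exact: (ux N).1.
apply: filterS (ip_eq0 (gk 0%N).1 g0) => y /eqP; rewrite subr_eq0 => /eqP ->.
by rewrite le_max lexx/= ge_max ler01 ge_min lexx.
Qed.

(** [semi_inner_max_attained] with [a = inner] and [b = green_form oOmega], whose diagonal is [J].
    The function 0 makes [V oOmega t] nonempty, and the constraint against the torsion function
    survives L^2 limits. *)
Lemma maximizer_exists (t : R) : 0 < t ->
  exists2 f, V oOmega t f & beta oOmega t = (J oOmega f)%:E.
Proof.
move=> t0.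
have L1 : L2 \1_Omega.
  apply: (@sqint_bounded _ _ _ _ muoo _ 1).
    by apply: measurable_indic; exact: open_measurable_rV.
  by apply: aeW => x; rewrite indicE; case: (_ \in _); rewrite ?normr1 ?normr0.
have Lpsi : L2 (torsion oOmega) := green_L2 bOmega i0 L1.
have [K K0 JK] := J_bounded oOmega bOmega i0.
have VD : V oOmega t `<=` L2 by move=> f [].
have uV f : V oOmega t f -> unit_valued f by move=> [].
have Lc1 : L2 (cst 1) by exact: sqint_cst.
have VM f : V oOmega t f -> inner f f <= inner (cst 1) (cst 1).
  move=> [Lf f01 _]; apply: (sqint_le (sqint_measurable Lf) Lc1 _).2.
  by apply: filterS f01 => x /andP[f0 f1]; rewrite normr1 ger0_norm.
have [f Vf fmax] : exists2 f, V oOmega t f &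
    forall g, V oOmega t g -> green_form oOmega g g <= green_form oOmega f f.
  apply: (@semi_inner_max_attained _ _ L2 (V oOmega t) inner (green_form oOmega)
    K (inner (cst 1) (cst 1)) sL hL (semi_inner_green oOmega bOmega i0)
    _ VD _ _ _ VM K0 JK).
  - by move=> x Dx cx; exact: sqint_complete.
  - exists 0; split; first exact: sL.1.
      by apply: aeW => x; rewrite lexx ler01.
    by rewrite (semi_inner0l sL hL)// ltW.
  - move=> f g [Lf f01 ft] [Lg g01 gt]; have Lfg := subspaceD sL Lf Lg; split.
    + exact: (subspaceZ sL).
    + apply: filterS2 f01 g01 => x /andP[h1 h2] /andP[h3 h4].
      rewrite -[(_ *: _) x]/(2^-1 * (f x + g x)); apply/andP; split; lra.
    + by rewrite (semi_innerZl sL hL)// (semi_innerDl hL)//; lra.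
  - move=> x y Vx Ly xy; have [_ y01] := unit_valued_limit (fun k => uV _ (Vx k)) Ly xy.
    split=> //; have l := limit_inner sL hL (fun k => VD _ (Vx k)) Ly xy Lpsi.
    rewrite -(cvg_lim _ l)//; apply: limr_le; first by apply/cvg_ex; eexists; exact: l.
    by apply: nearW => k; have [] := Vx k.
  - move=> e e0; have [I [c cP]] := green_totally_bounded e0.
    by exists I, c => f g Vf Vg; apply: cP; exact: uV.
exists f => //; apply/eqP; rewrite eq_le; apply/andP; split.
  by apply: ub_ereal_sup => _ [g Vg <-]; rewrite lee_fin; exact: fmax.
by apply: ereal_sup_ubound; exists f.
Qed.

End maximizer.

Theorem theorem1p1 (R : realType) (d : nat) (hd : (1 <= d)%N)
  (Omega : set 'rV[R]_d) (oOmega : open Omega) (bOmega : bounded_set Omega)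
  (t : R) (t_gt0 : 0 < t) (t_lt : t < inner oOmega (torsion oOmega) (cst 1)) :
  exists2 f, V oOmega t f & beta oOmega t = (J oOmega f)%:E.
(* [Ordinal hd] is the coordinate direction along which the Poincare inequality is proved. *)
Proof. exact (maximizer_exists oOmega bOmega (Ordinal hd) t_gt0). Qed.
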